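(* Let $h_1,h_2,h_3,l_1,l_2,l_3,\nu,\alpha\in\mathbb{C}$ and nonzero $t_1,t_2,t_3,x\in\mathbb{C}$ be parameters with $q^{2\nu}=q^{h_1+h_2+h_3-l_1-l_2-l_3+1}$. Put $$C_1=\frac{\theta\left(q^{h_1-l_1-\nu+1},\ \frac{t_1q^{h_1-l_2-\nu+1}}{t_2},\ \frac{t_1q^{h_1-l_3-\nu+1}}{t_3},\ \frac{xq^{\frac32-h_1}}{t_1},\ \frac{xq^{-h_2+\nu-\frac12}}{t_2},\ \frac{xq^{-h_3+\nu-\frac12}}{t_3}\right)}{\theta\left(q^{\nu-1},\ \frac{t_1q^{h_1-h_2}}{t_2},\ \frac{t_1q^{h_1-h_3}}{t_3},\ \frac{xq^{\frac12-l_1}}{t_1},\ \frac{xq^{\frac12-l_2}}{t_2},\ \frac{xq^{\frac12-l_3}}{t_3}\right)},$$ let $C_2$ be obtained from $C_1$ by the exchange $h_1\leftrightarrow h_2$, $l_1\leftrightarrow l_2$, $t_1\leftrightarrow t_2$, and let $C_3$ be obtained from $C_1$ by the exchange $h_1\leftrightarrow h_3$, $l_1\leftrightarrow l_3$, $t_1\leftrightarrow t_3$. For $i,j\in\{1,2,3,4\}$ let $$\varphi_{i,j}^{\mathcal{H}_3}=x^{\nu-\alpha}\int_{\tau_i}^{\tau_j}\frac{\left(q^\nu xt,\ q^{h_1+\frac12}t_1t,\ q^{h_2+\frac12}t_2t,\ q^{h_3+\frac12}t_3t\right)_\infty}{\left(xt,\ q^{\nu+l_1-\frac12}t_1t,\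 q^{\nu+l_2-\frac12}t_2t,\ q^{\nu+l_3-\frac12}t_3t\right)_\infty}\,d_qt,$$ where $\tau_i=q^{-h_i-1/2}/t_i$ for $i=1,2,3$ and $\tau_4=q^{1-\nu}/x$. Then $$C_1\,\varphi_{1,4}^{\mathcal{H}_3}+C_2\,\varphi_{2,4}^{\mathcal{H}_3}+C_3\,\varphi_{3,4}^{\mathcal{H}_3}=0.$$
   Context: Fix $q\in\mathbb{C}$ with $0<|q|<1$, together with a fixed branch of $\log q$ so that $q^c=e^{c\log q}$ for $c\in\mathbb{C}$, and a fixed choice of $\log x$ to define $x^{\nu-\alpha}$. Notation: $(a)_\infty=\prod_{i=0}^\infty(1-aq^i)$, $(a_1,\ldots,a_r)_\infty=(a_1)_\infty\cdots(a_r)_\infty$, $\theta(x)=(x)_\infty(q/x)_\infty$, $\theta(x_1,\ldots,x_r)=\theta(x_1)\cdots\theta(x_r)$. The Jackson integral is $\int_0^\tau f(t)\,d_qt=(1-q)\sum_{n=0}^\infty f(\tau q^n)\tau q^n$ and $\int_{\tau_1}^{\tau_2}f(t)\,d_qt=\int_0^{\tau_2}f(t)\,d_qt-\int_0^{\tau_1}f(t)\,d_qt$. Parameters are understood to be generic so that no denominator appearing in the $C_i$ or in the terms of the Jackson integrals vanishes. *)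

(* Defs.v *)
From mathcomp Require Export all_boot all_order all_algebra.
From mathcomp Require Export all_classical all_reals all_analysis.
From mathcomp Require Export complex.
Export Order.TTheory GRing.Theory Num.Theory.
Export numFieldNormedType.Exports.

Set Implicit Arguments.
Unset Strict Implicit.
Unset Printing Implicit Defensive.

Local Open Scope classical_set_scope.
Local Open Scope ring_scope.
Local Open Scope complex_scope.

(* The topology of R[i] is carried by its alias R[i]^o.  [lim] is total, but
   the two limits taken below exist whenever 0 < |q| < 1: the product always,
   the series for the integrand at hand as soon as its terms are defined. *)
Definition limC (R : realType) (u : nat -> R[i]) : R[i] :=
  lim ((u : nat -> R[i]^o) @ \oo).

Definition cexp (R : realType) (z : R[i]) : R[i] :=
  (expR (complex.Re z))%:C * (cos (complex.Im z) +i* sin (complex.Im z)).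

(* a ^ c for the branch of log a whose value is [loga] *)
Definition cpow (R : realType) (loga c : R[i]) : R[i] := cexp (c * loga).

Definition qpoch (R : realType) (q a : R[i]) : R[i] :=
  limC (fun n : nat => \prod_(i < n) (1 - a * q ^+ i)).

Definition qpochs (R : realType) (q : R[i]) (s : seq R[i]) : R[i] :=
  \prod_(a <- s) qpoch q a.

Definition theta (R : realType) (q x : R[i]) : R[i] :=
  qpoch q x * qpoch q (q / x).

Definition thetas (R : realType) (q : R[i]) (s : seq R[i]) : R[i] :=
  \prod_(x <- s) theta q x.

Definition jackson0 (R : realType) (q : R[i]) (f : R[i] -> R[i]) (tau : R[i])
    : R[i] :=
  (1 - q) * limC (fun N : nat =>
    \sum_(n < N) f (tau * q ^+ n) * (tau * q ^+ n)).

Definition jackson (R : realType) (q : R[i]) (f : R[i] -> R[i])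
    (tau1 tau2 : R[i]) : R[i] :=
  jackson0 q f tau2 - jackson0 q f tau1.

Definition C_num (R : realType) (q logq nu x h1 h2 h3 l1 l2 l3 t1 t2 t3 : R[i])
    : R[i] :=
  thetas q [:: cpow logq (h1 - l1 - nu + 1);
               t1 * cpow logq (h1 - l2 - nu + 1) / t2;
               t1 * cpow logq (h1 - l3 - nu + 1) / t3;
               x * cpow logq (3 / 2 - h1) / t1;
               x * cpow logq (- h2 + nu - 1 / 2) / t2;
               x * cpow logq (- h3 + nu - 1 / 2) / t3].

Definition C_den (R : realType) (q logq nu x h1 h2 h3 l1 l2 l3 t1 t2 t3 : R[i])
    : R[i] :=
  thetas q [:: cpow logq (nu - 1);
               t1 * cpow logq (h1 - h2) / t2;
               t1 * cpow logq (h1 - h3) / t3;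
               x * cpow logq (1 / 2 - l1) / t1;
               x * cpow logq (1 / 2 - l2) / t2;
               x * cpow logq (1 / 2 - l3) / t3].

Definition C_coef (R : realType)
    (q logq nu x h1 h2 h3 l1 l2 l3 t1 t2 t3 : R[i]) : R[i] :=
  C_num q logq nu x h1 h2 h3 l1 l2 l3 t1 t2 t3 /
  C_den q logq nu x h1 h2 h3 l1 l2 l3 t1 t2 t3.

Definition H3_num (R : realType) (q logq nu x h1 h2 h3 t1 t2 t3 t : R[i])
    : R[i] :=
  qpochs q [:: cpow logq nu * x * t;
               cpow logq (h1 + 1 / 2) * t1 * t;
               cpow logq (h2 + 1 / 2) * t2 * t;
               cpow logq (h3 + 1 / 2) * t3 * t].

Definition H3_den (R : realType) (q logq nu x l1 l2 l3 t1 t2 t3 t : R[i])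
    : R[i] :=
  qpochs q [:: x * t;
               cpow logq (nu + l1 - 1 / 2) * t1 * t;
               cpow logq (nu + l2 - 1 / 2) * t2 * t;
               cpow logq (nu + l3 - 1 / 2) * t3 * t].

(* tau_i for i = 1, 2, 3, 4; indices outside this range are not used *)
Definition H3_tau (R : realType) (logq nu x h1 h2 h3 t1 t2 t3 : R[i]) (i : nat)
    : R[i] :=
  match i with
  | 1 => cpow logq (- h1 - 1 / 2) / t1
  | 2 => cpow logq (- h2 - 1 / 2) / t2
  | 3 => cpow logq (- h3 - 1 / 2) / t3
  | _ => cpow logq (1 - nu) / x
  end.

Definition phi_H3 (R : realType)
    (q logq logx nu alpha x h1 h2 h3 l1 l2 l3 t1 t2 t3 : R[i]) (i j : nat)
    : R[i] :=
  cpow logx (nu - alpha) *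
  jackson q
    (fun t => H3_num q logq nu x h1 h2 h3 t1 t2 t3 t /
              H3_den q logq nu x l1 l2 l3 t1 t2 t3 t)
    (H3_tau logq nu x h1 h2 h3 t1 t2 t3 i)
    (H3_tau logq nu x h1 h2 h3 t1 t2 t3 j).

(* Main.v *)
(* Put [a_i = q^(h_i+1/2) t_i], [b_i = q^(nu+l_i-1/2) t_i] for [i <= 3], [a_4 = q^nu x]
   and [b_4 = x]; the condition on [nu] says [\prod a_i = q^2 \prod b_i], and, the first
   term at [tau_i = 1 / a_i] being zero, all four integrals start at [q / a_i].
   The function [\prod_j (q u / b_j)_oo / (q u / a_j)_oo] has simple poles at
   [a_k q^(-n-1)]; for each [k] its residues add up to the Jackson integral from [0] to
   [q / a_k] times a weight [V_k] built from theta functions, and the sum of all residues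
   is zero.  Truncating the products after finitely many factors turns this into the
   vanishing of the sum of residues of a rational function, i.e. into Lagrange
   interpolation; the truncated residues are [X_k (N - n) * S_k n] with [X_k] convergent
   and [S_k] geometrically small, so that the limit is that of a Cauchy product.
   A numerator for which the inner sums telescope gives [\sum_k V_k = 0] in the same way.
   As [C_k = - V_k / V_4], both relations together are the claim.  If
   [theta (a_4 / a_k) = 0] for some [k], the weights make no sense, but then the other two
   coefficients vanish, and so does [phi_{k,4}] because [a_4 / a_k] is a power of [q]. *)
Require Import Defs.
From mathcomp Require Import ring lra zify.

Set Implicit Arguments.
Unset Strict Implicit.
Unset Printing Implicit Defensive.

Local Open Scope classical_set_scope.
Local Open Scope ring_scope.
Local Open Scope complex_scope.

Import ComplexField.Normc.

(** * Residues of truncated products *)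

(** The sum is the coefficient of degree [#|I|.-1] in the Lagrange interpolant of [Q] at the nodes
    [p i]; the interpolant is [Q] itself, whose degree is smaller. *)
Lemma sum_lagrange0 (F : fieldType) (I : finType) (p : I -> F) (Q : {poly F}) :
  injective p -> (size Q < #|I|)%N ->
  \sum_i Q.[p i] / \prod_(j | j != i) (p i - p j) = 0.
Proof.
move=> pI sQ.
pose D i := \prod_(j | j != i) (p i - p j).
pose M i := \prod_(j | j != i) ('X - (p j)%:P).
have D0 i : D i != 0.
  by apply/prodf_neq0 => j ji; rewrite subr_eq0 (inj_eq pI) eq_sym.
have ME i : (M i).[p i] = D i.
  by rewrite /M horner_prod; apply: eq_bigr => j _; rewrite hornerXsubC.
have M0 i j : j != i -> (M i).[p j] = 0.
  move=> ji; rewrite /M horner_prod (bigD1 j) //= hornerXsubC subrr mul0r //.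
have sM i : size (M i) = #|I|.
  rewrite /M -big_filter size_prod_XsubC size_filter -sum1_count.
  by rewrite -sum1_card [RHS](bigD1 i) //= add1n.
have Mm i : M i \is monic by rewrite /M -big_filter monic_prod_XsubC.
pose L := \sum_i (Q.[p i] / D i) *: M i.
have QL : Q = L.
  apply/eqP; rewrite -subr_eq0; apply/eqP.
  apply: (@roots_geq_poly_eq0 _ _ [seq p i | i <- enum I]).
  - apply/allP => _ /mapP[i _ ->]; apply/rootP.
    rewrite hornerD hornerN horner_sum (bigD1 i) //= hornerZ ME.
    rewrite divfK // big1 ?addr0 ?subrr // => j ji.
    by rewrite hornerZ M0 ?mulr0 // eq_sym.
  - by rewrite map_inj_uniq ?enum_uniq.
  - rewrite size_map -cardE.
    rewrite (leq_trans (size_polyD _ _)) // geq_max ltnW //= size_polyN.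
    apply: (leq_trans (size_sum _ _ _)); apply/bigmax_leqP => i _.
    by rewrite (leq_trans (size_scale_leq _ _)) // sM.
have /(congr1 (fun P : {poly F} => P`_(#|I|.-1))) := QL.
rewrite nth_default; last by case: #|I| sQ.
rewrite /L coef_sum => L0; rewrite [RHS]L0; apply: eq_bigr => i _.
have := Mm i; rewrite coefZ monicE lead_coefE sM => /eqP ->.
by rewrite mulr1.
Qed.

Lemma sum_lagrange0_ratio (F : fieldType) (I : finType) (p : I -> F) (Q : {poly F}) :
  injective p -> (forall i, p i != 0) -> (size Q < #|I|)%N ->
  \sum_i p i * Q.[p i] / \prod_(j | j != i) (1 - p i / p j) = 0.
Proof.
move=> pI p0 sQ; have := sum_lagrange0 pI sQ.
move=> /(congr1 (fun x => - (\prod_j (- p j)) * x)); rewrite mulr0 => H.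
rewrite -[RHS]H mulr_sumr; apply: eq_bigr => i _.
rewrite [in RHS](bigD1 i) //=.
have -> : \prod_(j | j != i) (p i - p j) =
    \prod_(j | j != i) (- p j) * \prod_(j | j != i) (1 - p i / p j).
  rewrite -big_split /=; apply: eq_bigr => j _.
  by rewrite mulNr mulrBr mulr1 mulrCA divff // mulr1 opprB.
have P0 : \prod_(j | j != i) (- p j) != 0.
  by apply/prodf_neq0 => j _; rewrite oppr_eq0.
rewrite invfM !mulNr opprK -!mulrA; congr (_ * _).
by rewrite [RHS]mulrCA; congr (_ * _); rewrite mulrA divff // mul1r.
Qed.

(** Both products are monic, so the leading terms cancel; the constant terms cancel by hypothesis,
    so [u] divides the difference. Such a [P] is the numerator for which the residues telescope. *)
Lemma prod_XsubC_diff (F : fieldType) (I : finType) (a b : I -> F) :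
  (0 < #|I|)%N -> \prod_k a k = \prod_k b k ->
  exists2 P : {poly F}, (size P < #|I|)%N &
    forall u, u * P.[u] = \prod_k (u - a k) - \prod_k (u - b k).
Proof.
move=> I0 ab.
pose T (c : I -> F) := \prod_k ('X - (c k)%:P).
have TE c u : (T c).[u] = \prod_k (u - c k).
  by rewrite horner_prod; apply: eq_bigr => k _; rewrite hornerXsubC.
have sT c : size (T c) = #|I|.+1 by rewrite size_prod_XsubC -sum1_size sum1_card.
have Tm c : T c \is monic by exact: monic_prod_XsubC.
have sD : (size (T a - T b)%R <= #|I|)%N.
  apply/leq_sizeP => j; rewrite leq_eqVlt => /predU1P[<-|h]; last first.
    by rewrite coefB !nth_default ?sT // subrr.
  have lc c : (T c)`_#|I| = 1 by have := Tm c; rewrite monicE lead_coefE sT => /eqP.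
  by rewrite coefB !lc subrr.
have /factor_theorem[P PD] : root (T a - T b) 0.
  rewrite rootE hornerD hornerN !TE.
  under eq_bigr do rewrite sub0r; under [X in _ - X]eq_bigr do rewrite sub0r.
  by rewrite !prodrN ab subrr.
exists P; last first.
  by move=> u; rewrite -!TE -hornerN -hornerD PD hornerM hornerXsubC subr0 mulrC.
have [->|P0] := eqVneq P 0; first by rewrite size_poly0.
by move: sD; rewrite PD subr0 size_mulX.
Qed.

Definition qpochn (F : fieldType) (q a : F) (n : nat) : F :=
  \prod_(i < n) (1 - a * q ^+ i).

Lemma qpochn0 (F : fieldType) (q a : F) : qpochn q a 0 = 1.
Proof. by rewrite /qpochn big_ord0. Qed.

Lemma qpochnS (F : fieldType) (q a : F) n :
  qpochn q a n.+1 = qpochn q a n * (1 - a * q ^+ n).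
Proof. by rewrite /qpochn big_ord_recr. Qed.

Lemma qpochnSl (F : fieldType) (q a : F) n :
  qpochn q a n.+1 = (1 - a) * qpochn q (a * q) n.
Proof.
rewrite /qpochn big_ord_recl expr0 mulr1; congr (_ * _).
by apply: eq_bigr => i _; rewrite -mulrA -exprS.
Qed.

Lemma qpochnD (F : fieldType) (q a : F) m n :
  qpochn q a (m + n) = qpochn q a m * qpochn q (a * q ^+ m) n.
Proof.
elim: n => [|n IH]; first by rewrite addn0 qpochn0 mulr1.
by rewrite addnS !qpochnS IH -!mulrA -exprD.
Qed.

(** Each of the first [n] factors is turned over by [1 - z = - z * (1 - z^-1)]. *)
Lemma qpochn_reflect (F : fieldType) (q y : F) n m : q != 0 -> y != 0 ->
  qpochn q (y * q ^- n) (n + m) =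
  (\prod_(i < n) - (y * q ^- i.+1)) * qpochn q (q / y) n * qpochn q y m.
Proof.
move=> q0 y0; elim: n => [|n IH].
  by rewrite big_ord0 qpochn0 expr0 invr1 mulr1 add0n !mul1r.
have qn0 : q ^+ n != 0 by rewrite expf_neq0.
rewrite addSn qpochnSl.
have -> : y * q ^- n.+1 * q = y * q ^- n by rewrite exprSr invfM mulrA divfK.
rewrite IH big_ord_recr /= qpochnS exprS.
set a := \prod_(i < n) _; set b := qpochn _ _ n; set c := qpochn _ _ m.
by move: (q ^+ n) qn0 => Q Q0; field; rewrite q0 y0 Q0.
Qed.

Lemma poly_qpochn (F : fieldType) (q c : F) n :
  exists2 P : {poly F}, (size P <= n.+1)%N & forall u, P.[u] = qpochn q (u * c) n.
Proof.
exists (\prod_(i < n) (1 - (c * q ^+ i) *: 'X)).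
  elim: n => [|n IH]; first by rewrite big_ord0 size_polyC oner_eq0.
  rewrite big_ord_recr /= (leq_trans (size_polyMleq _ _)) //.
  have s2 : (size (1 - (c * q ^+ n) *: 'X)%R <= 2)%N.
    rewrite (leq_trans (size_polyD _ _)) // geq_max size_polyN size_polyC oner_eq0.
    by rewrite (leq_trans (size_scale_leq _ _)) ?size_polyX.
  by move: s2 IH; set a := size _; set b := size _; lia.
move=> u; rewrite horner_prod; apply: eq_bigr => i _.
by rewrite hornerD hornerN hornerZ hornerX hornerC mulrC mulrA.
Qed.

(** The contribution to the residue at a pole of the other poles in its own progression: the omitted
    factor is the vanishing one, those before it are reflected with [y = 1], those after it give
    [qpochn q q (N - n)]. *)
Lemma prod_qpow_omit (F : fieldType) (q : F) n N : q != 0 -> (n <= N)%N ->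
  \prod_(i < N.+1 | i != n :> nat) (1 - q ^- n * q ^+ i) =
  (\prod_(i < n) - q ^- i.+1) * qpochn q q n * qpochn q q (N - n).
Proof.
move=> q0 nN.
rewrite -(big_mkord (fun i => i != n) (fun i => 1 - q ^- n * q ^+ i)).
rewrite (@big_cat_nat _ _ _ n) //=; last by rewrite ltnW.
rewrite [X in _ * X]big_ltn_cond ?ltnS // eqxx /=; congr (_ * _).
  have := qpochn_reflect n 0 q0 (oner_neq0 F).
  rewrite qpochn0 addn0 mulr1 divr1 mul1r.
  rewrite (eq_bigr (fun i : 'I_n => - q ^- i.+1)) => [<-|i _]; last by rewrite mul1r.
  rewrite /qpochn -(big_mkord xpredT (fun i => 1 - q ^- n * q ^+ i)).
  by rewrite big_nat_cond [RHS]big_nat_cond; apply: eq_bigl => i;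
    case: ltngtP => //=; rewrite ?andbF.
rewrite -[n.+1]add0n big_addn subSS big_mkord /qpochn.
apply: eq_big => [i|i _]; first by lia.
by rewrite addnS exprS exprD mulrC -mulrA mulfK // expf_neq0.
Qed.

(* [res_left k (N - n) * res_right k n] is, up to a common factor, the residue at
   [u = A k * q ^- n] of
   [P u * \prod_j (u / B j; q)_N / \prod_j (u / A j; q)_(N+1)]. *)
Definition res_left (F : fieldType) (I : finType) (q : F) (A B : I -> F) k m : F :=
  (\prod_j qpochn q (A k / B j) m) /
  (qpochn q q m * \prod_(j | j != k) qpochn q (A k / A j) m.+1).

Definition res_right (F : fieldType) (I : finType) (q : F) (A B : I -> F)
    (P : {poly F}) k n : F :=
  A k * q ^- n * P.[A k * q ^- n] * (\prod_j (A j / B j)) ^+ n *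
  \prod_j (qpochn q (q * B j / A k) n / qpochn q (q * A j / A k) n).

(** Interpolation at the [#|I| * N.+1] points [A k * q ^- n]. Reflecting every finite product splits
    each residue into a factor depending on [N - n] and one depending on [n], the shape of a
    convolution. *)
Lemma sum_residues_finite (F : fieldType) (I : finType) (q : F) (A B : I -> F)
    (P : {poly F}) (N : nat) :
  q != 0 -> (forall k, A k != 0) -> (forall k, B k != 0) ->
  (forall j k m n, A j * q ^- m = A k * q ^- n -> j = k /\ m = n) ->
  (size P < #|I|)%N ->
  \sum_k \sum_(n < N.+1) res_left q A B k (N - n) * res_right q A B P k n = 0.
Proof.
move=> q0 A0 B0 Ainj sP.
have qn0 n : q ^+ n != 0 by rewrite expf_neq0.
pose p (x : I * 'I_N.+1) := A x.1 * q ^- x.2.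
have pinj : injective p.
  by move=> [j m] [k n] /Ainj /= [-> /val_inj ->].
have p0 x : p x != 0 by rewrite mulf_neq0 // invr_eq0.
have /fin_all_exists2[T sT eT] j := poly_qpochn q (B j)^-1 N.
pose Q := P * \prod_j T j.
have I0 : (0 < #|I|)%N by case: #|I| sP.
have sTT : (size (\prod_j T j)%R <= (#|I| * N).+1)%N.
  rewrite (leq_trans (size_prod_leq _ _)) //.
  have : (\sum_j size (T j) <= #|I| * N.+1)%N by rewrite -sum_nat_const leq_sum.
  rewrite mulnS; move: (\sum_j _)%N (#|I| * N)%N => s c.
  rewrite (_ : #|[pred _ : I | true]| = #|I|); first by lia.
  exact: eq_card.
(* Having [N] factors above against [N.+1] below for each [j] leaves exactly the room allowed by
   [size P < #|I|]. *)
have sQ : (size Q < #|{: I * 'I_N.+1}|)%N.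
  rewrite card_prod card_ord (leq_ltn_trans (size_polyMleq _ _)) //.
  by move: sTT; move: (size _) => s; nia.
have H := sum_lagrange0_ratio pinj p0 sQ.
rewrite -(pair_bigA _ (fun k n => p (k, n) * Q.[p (k, n)] /
  \prod_(y | y != (k, n)) (1 - p (k, n) / p y))) /= in H.
rewrite -[RHS]H.
apply: eq_bigr => k _; apply: eq_bigr => n _.
have nN : (n <= N)%N by rewrite -ltnS.
(* The other poles are those in the progression of [A k] and, for each [j != k], the whole
   progression of [A j]. *)
have -> : \prod_(y | y != (k, n)) (1 - p (k, n) / p y) =
   (\prod_(i < N.+1 | i != n :> nat) (1 - q ^- n * q ^+ i)) *
   \prod_(j | j != k) qpochn q (A k / A j * q ^- n) N.+1.
  pose G j (i : 'I_N.+1) := 1 - p (k, n) / p (j, i).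
  rewrite (eq_bigr (fun y => G y.1 y.2)); last by case.
  rewrite (eq_bigl (fun y => true && (y != (k, n)))) //.
  rewrite -(pair_big_dep xpredT (fun j i => (j, i) != (k, n)) G) /=.
  rewrite (bigD1 k) //=; congr (_ * _).
    apply: eq_big => [i|i _]; first by rewrite xpair_eqE eqxx.
    by rewrite /G /p /= invfM invrK mulrACA divff // mul1r.
  apply: eq_bigr => j jk; apply: eq_big => [i|i _]; first by rewrite xpair_eqE (negPf jk).
  by rewrite /G /p /= invfM invrK mulrACA mulrA.
rewrite prod_qpow_omit // /Q hornerM horner_prod.
under [in RHS]eq_bigr do rewrite eT.
pose c y := \prod_(i < n) - (y * q ^- i.+1).
have c0 y : y != 0 -> c y != 0.
  by move=> y0; apply/prodf_neq0 => i _; rewrite oppr_eq0 mulf_neq0 // invr_eq0.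
(* The reflection prefactors above and below differ by this power only; it becomes the geometric
   factor of [res_right]. *)
have cB j : c (A k / B j) = (A j / B j) ^+ n * c (A k / A j).
  rewrite -[n in _ ^+ n]card_ord -prodr_const -big_split /=.
  by apply: eq_bigr => i _; rewrite mulrN; congr (- _);
    move: (q ^- _) => z; field; rewrite B0 A0.
have eB j : qpochn q (p (k, n) / B j) N = ((A j / B j) ^+ n * c (A k / A j)) *
    qpochn q (q * B j / A k) n * qpochn q (A k / B j) (N - n).
  have := @qpochn_reflect _ q (A k / B j) n (N - n) q0.
  rewrite subnKC // mulf_neq0 ?invr_eq0 // -/(c _) cB invf_div mulrA /p /= mulrAC.
  exact.
have eA j : qpochn q (A k / A j / q ^+ n) N.+1 = c (A k / A j) *
    qpochn q (q * A j / A k) n * qpochn q (A k / A j) (N - n).+1.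
  have := @qpochn_reflect _ q (A k / A j) n (N - n).+1 q0.
  rewrite addnS subnKC // mulf_neq0 ?invr_eq0 // -/(c _) invf_div mulrA.
  exact.
rewrite (eq_bigr _ (fun j _ => eB j)) (eq_bigr _ (fun j _ => eA j)).
rewrite !big_split /= prodrXl (bigD1 k (F := fun j => c _)) //= divff //.
have -> : c 1 = \prod_(i < n) - q ^- i.+1.
  by apply: eq_bigr => i _; rewrite mul1r.
have ck0 : \prod_(j | j != k) c (A k / A j) != 0.
  by apply/prodf_neq0 => j _; rewrite c0 // mulf_neq0 // invr_eq0.
have c10 : \prod_(i < n) - q ^- i.+1 != 0.
  by apply/prodf_neq0 => i _; rewrite oppr_eq0 invr_eq0.
rewrite /res_left /res_right !big_split /=.
rewrite [\prod_j (qpochn q (q * A j / A k) n)^-1](bigD1 k) //= mulfK //.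
have e3 : (\prod_(j | j != k) qpochn q (q * A j / A k) n)^-1 =
  \prod_(j | j != k) (qpochn q (q * A j / A k) n)^-1 by rewrite prodfV.
rewrite !invfM /p /= e3.
move: ck0 c10; set u1 := \prod_(j | j != k) c _; set u2 := \prod_(i < n) - _.
set a1 := (qpochn q q n)^-1; set a2 := (qpochn q q _)^-1.
set a3 := \prod_(j | j != k) (qpochn q (q * A j / A k) n)^-1.
set a4 := (\prod_(j | j != k) qpochn q (A k / A j) (N - n).+1)^-1.
set a5 := \prod_j qpochn q (q * B j / A k) n.
set a6 := \prod_j qpochn q (A k / B j) (N - n).
set a7 := (_ * _) ^+ n; move: (P.[_]) => a8.
move: a1 a2 a3 a4 a5 a6 a7 u1 u2 => a1 a2 a3 a4 a5 a6 a7 u1 u2 u10 u20.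
by move: (q ^- n) => a9; field; rewrite u10 u20.
Qed.

(** * Limits of complex sequences *)

(* Over an abstract [K] these unify at once; applying [cvgM] directly on [R[i]^o]
   diverges while comparing the two topologies on [R[i]]. *)
Lemma regular_cvgD (K : numFieldType) (u v : nat -> K) (l k : K) :
  (u : nat -> K^o) @ \oo --> (l : K^o) -> (v : nat -> K^o) @ \oo --> (k : K^o) ->
  ((fun n => u n + v n) : nat -> K^o) @ \oo --> (l + k : K^o).
Proof. exact: cvgD. Qed.

Lemma regular_cvgM (K : numFieldType) (u v : nat -> K) (l k : K) :
  (u : nat -> K^o) @ \oo --> (l : K^o) -> (v : nat -> K^o) @ \oo --> (k : K^o) ->
  ((fun n => u n * v n) : nat -> K^o) @ \oo --> (l * k : K^o).
Proof. exact: cvgM. Qed.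

Lemma regular_cvgV (K : numFieldType) (u : nat -> K) (l : K) : l != 0 ->
  (u : nat -> K^o) @ \oo --> (l : K^o) ->
  ((fun n => (u n)^-1) : nat -> K^o) @ \oo --> (l^-1 : K^o).
Proof. exact: cvgV. Qed.

Section ComplexSequences.
Variable R : realType.
Implicit Types (u v : nat -> R[i]) (l k z : R[i]).

(** As [limC] is total, its value is recorded together with the existence of the limit. *)
Definition cvgC u l : Prop :=
  cvg ((u : nat -> R[i]^o) @ \oo) /\ limC u = l.

Lemma cvgCP u l : cvgC u l <-> (u : nat -> R[i]^o) @ \oo --> (l : R[i]^o).
Proof.
split=> [[cu <-]|h]; first exact: cu.
by split; [exact: cvgP h | apply: cvg_lim h; exact: norm_hausdorff].
Qed.

Lemma normr_normc z : `|z| = (normc z)%:C.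
Proof. by rewrite normc_def; case: z. Qed.

Lemma normc_ge0 z : 0 <= normc z.
Proof. by case: z => a b; exact: sqrtr_ge0. Qed.

Lemma cvgC_normP u l :
  cvgC u l <-> (fun n => normc (u n - l)) @ \oo --> (0 : R).
Proof.
split.
  move=> /cvgCP/cvgrPdist_le H; apply/cvgr0Pnorm_le => e e0.
  have := H e%:C; rewrite ltcR => /(_ e0); apply: filterS => n.
  by rewrite distrC normr_normc lecR ger0_norm // normc_ge0.
move=> /cvgr0Pnorm_le H; apply/cvgCP/cvgrPdist_le => e e0.
(* In the partial order of [R[i]] a positive element has zero imaginary part. *)
have eE : e = (complex.Re e)%:C.
  by case: e e0 => a b; rewrite ltcE /= => /andP[/eqP -> _].
have := H (complex.Re e); rewrite -ltcR -eE => /(_ e0); apply: filterS => n.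
by rewrite distrC normr_normc eE lecR ger0_norm // normc_ge0.
Qed.

Lemma cvgC_lim u l : cvgC u l -> limC u = l.
Proof. by case. Qed.

Lemma cvgC_eq u v l : u =1 v -> cvgC u l -> cvgC v l.
Proof. by move=> /funext ->. Qed.

Lemma cvgC_cst l : cvgC (fun=> l) l.
Proof. by apply/cvgCP; exact: cvg_cst. Qed.

Lemma cvgCD u v l k : cvgC u l -> cvgC v k -> cvgC (fun n => u n + v n) (l + k).
Proof.
by move=> /cvgCP hu /cvgCP hv; apply/cvgCP; exact: (regular_cvgD hu hv).
Qed.

Lemma cvgCM u v l k : cvgC u l -> cvgC v k -> cvgC (fun n => u n * v n) (l * k).
Proof.
by move=> /cvgCP hu /cvgCP hv; apply/cvgCP; exact: (regular_cvgM hu hv).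
Qed.

Lemma cvgCV u l : l != 0 -> cvgC u l -> cvgC (fun n => (u n)^-1) l^-1.
Proof.
by move=> l0 /cvgCP hu; apply/cvgCP; exact: (regular_cvgV l0 hu).
Qed.

Lemma cvgC_shift m u l : cvgC (fun n => u (n + m)%N) l <-> cvgC u l.
Proof. by rewrite !cvgCP (cvg_shiftn m (u : nat -> R[i]^o)). Qed.

Lemma cvgC_unique u l k : cvgC u l -> cvgC u k -> l = k.
Proof. by move=> /cvgC_lim <- /cvgC_lim <-. Qed.

Lemma cvgC_sum (I : Type) (r : seq I) (u : I -> nat -> R[i]) (l : I -> R[i]) :
  (forall i, cvgC (u i) (l i)) ->
  cvgC (fun n => \sum_(i <- r) u i n) (\sum_(i <- r) l i).
Proof.
move=> h; elim: r => [|i r IH].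
  by rewrite big_nil; apply: (cvgC_eq _ (cvgC_cst 0)) => n; rewrite big_nil.
rewrite big_cons; apply: (cvgC_eq _ (cvgCD (h i) IH)) => n; by rewrite big_cons.
Qed.

Lemma cvgC_prod (I : Type) (r : seq I) (P : pred I) (u : I -> nat -> R[i])
    (l : I -> R[i]) :
  (forall i, cvgC (u i) (l i)) ->
  cvgC (fun n => \prod_(i <- r | P i) u i n) (\prod_(i <- r | P i) l i).
Proof.
move=> h; elim: r => [|i r IH].
  by rewrite big_nil; apply: (cvgC_eq _ (cvgC_cst 1)) => n; rewrite big_nil.
rewrite big_cons; case: ifP => Pi.
  by apply: (cvgC_eq _ (cvgCM (h i) IH)) => n; rewrite big_cons Pi.
by apply: (cvgC_eq _ IH) => n; rewrite big_cons Pi.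
Qed.

Lemma cvgC_expr z : normc z < 1 -> cvgC (fun n => z ^+ n) 0.
Proof.
move=> z1; apply/cvgC_normP.
have E n : normc (z ^+ n - 0) = normc z ^+ n.
  rewrite subr0; elim: n => [|n IH]; first exact: normc1.
  by rewrite !exprS normcM IH.
under eq_fun do rewrite E.
by apply: cvg_expr; rewrite ger0_norm ?normc_ge0.
Qed.

(** The increments of the real and imaginary parts are dominated by a geometric series, so their
    telescoping series converge absolutely in [R]. *)
Lemma cvgC_geometric_increments u (M r : R) : 0 <= r < 1 ->
  (forall n, normc (u n.+1 - u n) <= M * r ^+ n) -> exists l, cvgC u l.
Proof.
move=> /andP[r0 r1] H.
have cvgR (f : nat -> R) : (forall n, `|f n.+1 - f n| <= M * r ^+ n) -> cvgn f.
  move=> Hf.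
  have : cvgn (series (telescope f)).
    apply: (@normed_cvg R R^o).
    apply: (@series_le_cvg _ _ (geometric M r)).
    - by move=> n; exact: normr_ge0.
    - by move=> n; exact: le_trans (normr_ge0 _) (Hf n).
    - exact: Hf.
    - by apply: is_cvg_geometric_series; rewrite ger0_norm.
  move=> H1; apply/cvg_ex; exists (f 0%N + limn (series (telescope f))).
  have : (fun n => f 0%N + series (telescope f) n) @ \oo -->
      f 0%N + limn (series (telescope f)) by apply: cvgD => //; exact: cvg_cst.
  by rewrite -(_ : f = (fun n => f 0%N + series (telescope f) n)) //;
    apply/funext => n; exact: eq_sum_telescope.
have leRe z : `|complex.Re z| <= normc z.
  by case: z => a b /=; rewrite -sqrtr_sqr ler_wsqrtr // lerDl sqr_ge0.
have leIm z : `|complex.Im z| <= normc z.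
  by case: z => a b /=; rewrite -sqrtr_sqr ler_wsqrtr // lerDr sqr_ge0.
have /cvg_ex[/= x Hx] : cvgn (fun n => complex.Re (u n)).
  apply: cvgR => n; apply: le_trans (H n); apply: le_trans (leRe _).
  by rewrite raddfB.
have /cvg_ex[/= y Hy] : cvgn (fun n => complex.Im (u n)).
  apply: cvgR => n; apply: le_trans (H n); apply: le_trans (leIm _).
  by rewrite raddfB.
exists (x +i* y); apply/cvgC_normP.
apply: (@squeeze_cvgr _ _ _ _ (cst 0)
  (fun n => `|complex.Re (u n) - x| + `|complex.Im (u n) - y|)).
- apply: nearW => n; rewrite normc_ge0 /=.
  case: (u n) => a b /=.
  rewrite -[leRHS]ger0_norm ?addr_ge0 // -sqrtr_sqr ler_wsqrtr //.
  have eA : (a - x) ^+ 2 = `|a - x| ^+ 2 by rewrite real_normK ?num_real.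
  have eB : (b - y) ^+ 2 = `|b - y| ^+ 2 by rewrite real_normK ?num_real.
  rewrite eA eB; move: (normr_ge0 (a - x)) (normr_ge0 (b - y)); nra.
- exact: cvg_cst.
- rewrite -[0]addr0 -{1}(normr0 R) -{2}(normr0 R) -{1}(subrr x) -{1}(subrr y).
  apply: cvgD; apply: cvg_norm; apply: cvgB => //; exact: cvg_cst.
Qed.
End ComplexSequences.

(** Once [e n <= (1 - r) * (eps / 2)], the recursion is dominated by an affine contraction with
    fixed point [eps / 2], so [t] is at most [eps / 2] plus a geometric term. *)
Lemma contraction_cvg0 (R : realType) (t e : nat -> R) (r : R) : 0 <= r < 1 ->
  (forall n, 0 <= t n) -> (forall n, t n.+1 <= r * t n + e n) ->
  e @ \oo --> 0 -> t @ \oo --> 0.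
Proof.
move=> /andP[r0 r1] t0 te e0; apply/cvgr0Pnorm_le => eps eps0.
have d0 : 0 < (1 - r) * (eps / 2) by nra.
have [M _ HM] := (cvgr0Pnorm_le e).1 e0 _ d0.
have HtM k : t (M + k)%N <= r ^+ k * t M + eps / 2.
  elim: k => [|k IH]; first by rewrite addn0 expr0; lra.
  rewrite addnS exprS; have := te (M + k)%N; have := HM (M + k)%N (leq_addr _ _).
  move=> /ler_normlP[_]; nra.
have /cvgr0Pnorm_le/(_ (eps / 2)) : (fun k => r ^+ k * t M) @ \oo --> (0 : R).
  by rewrite -[0](mul0r (t M)); apply: cvgMr_tmp; apply: cvg_expr; rewrite ger0_norm.
case; [lra | move=> K _ HK].
exists (M + K)%N => // n /= MKn.
rewrite ger0_norm // -(subnKC (leq_trans (leq_addr K M) MKn)).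
apply: le_trans (HtM _) _.
have := HK (n - M)%N; rewrite /= leq_subRL ?(leq_trans (leq_addr K M)) // => /(_ MKn).
move=> /ler_normlP[_]; lra.
Qed.

(** * Cauchy products of a convergent and a geometrically small sequence *)

Section Convolution.
Variable R : realType.
Implicit Types (u x s : nat -> R[i]) (C r : R).

Lemma normc_sum (I : Type) (l : seq I) (P : pred I) (F : I -> R[i]) :
  normc (\sum_(i <- l | P i) F i) <= \sum_(i <- l | P i) normc (F i).
Proof.
elim/big_ind2: _ => [|a b c d h1 h2|i _]; rewrite ?normc0 //.
by apply: le_trans (le_normcD _ _) _; exact: lerD.
Qed.

Lemma cvgC_bounded u l : cvgC u l -> exists M : R, forall n, normc (u n) <= M.
Proof.
move=> /cvgC_normP h.
have /bounded_fun_has_ubound[M HM] := cvg_seq_bounded (cvgP _ h).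
exists (M + normc l) => n.
rewrite -[u n](subrK l); apply: le_trans (le_normcD _ _) _.
by rewrite lerD2r; apply: HM; exists n.
Qed.

Lemma cvgC_series_geometric s C r : 0 <= r < 1 ->
  (forall n, normc (s n) <= C * r ^+ n) ->
  exists L, cvgC (fun N => \sum_(n < N) s n) L.
Proof.
move=> r01 H; apply: (cvgC_geometric_increments r01) => n.
by rewrite big_ord_recr /= addrC addrK.
Qed.

(** Replacing every [x (N - n)] by [X] gives the limit. The error is bounded by [t N], which
    satisfies [t N.+1 = r * t N + C * e N.+1] with [e] tending to zero. *)
Lemma cvgC_convolution x s X L C r : 0 <= r < 1 -> cvgC x X ->
  (forall n, normc (s n) <= C * r ^+ n) ->
  cvgC (fun N => \sum_(n < N) s n) L ->
  cvgC (fun N => \sum_(n < N.+1) x (N - n)%N * s n) (X * L).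
Proof.
move=> r01 hx hs hL.
have /andP[r0 r1] := r01.
have C0 : 0 <= C by have := le_trans (normc_ge0 _) (hs 0%N); rewrite expr0 mulr1.
have h2 : cvgC (fun N => X * \sum_(n < N.+1) s n) (X * L).
  apply: cvgCM (cvgC_cst X) _.
  by apply: (cvgC_eq _ ((cvgC_shift 1 _ _).2 hL)) => n; rewrite addn1.
pose d N := \sum_(n < N.+1) (x (N - n)%N - X) * s n.
have h1 : cvgC d 0.
  pose e m := normc (x m - X).
  pose t N := \sum_(n < N.+1) e (N - n)%N * (C * r ^+ n).
  have e0 m : 0 <= e m by exact: normc_ge0.
  have t0 N : 0 <= t N.
    by apply: sumr_ge0 => n _; rewrite !mulr_ge0 ?exprn_ge0.
  apply/cvgC_normP; apply: (@squeeze_cvgr _ _ _ _ (cst 0) t).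
  - apply: nearW => N; rewrite normc_ge0 subr0 /=.
    apply: le_trans (normc_sum _ _ _) _; apply: ler_sum => n _.
    by rewrite normcM; apply: ler_wpM2l; [exact: e0 | exact: hs].
  - exact: cvg_cst.
  - apply: (@contraction_cvg0 _ t (fun n => C * e n.+1) r r01 t0).
      move=> n; rewrite /t big_ord_recl subn0 expr0 mulr1 addrC mulr_sumr.
      rewrite lerD // 1?mulrC //; apply: ler_sum => i _.
      by rewrite /= subSS exprS [r * (_ * _)]mulrCA [r * (_ * _)]mulrCA.
    have /cvgC_normP h : cvgC (fun n => x (n + 1)%N) X := (cvgC_shift 1 _ _).2 hx.
    rewrite -(mulr0 C); apply: cvgMl_tmp.
    by move: h; under eq_fun do rewrite addn1.
have := cvgCD h1 h2; rewrite add0r; apply: cvgC_eq => N.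
rewrite /d mulr_sumr -big_split /=; apply: eq_bigr => n _.
by rewrite mulrBl subrK.
Qed.

End Convolution.

(** * Infinite products and theta functions *)

Section QPochhammer.
Variables (R : realType) (q : R[i]).
Hypotheses (q0 : q != 0) (q1 : normc q < 1).
Implicit Types (a b z : R[i]).

Let r01 : 0 <= normc q < 1.
Proof. by rewrite normc_ge0 q1. Qed.

Lemma normcX z n : normc (z ^+ n) = normc z ^+ n.
Proof. by elim: n => [|n IH]; [exact: normc1 | rewrite !exprS normcM IH]. Qed.

(** Induction on the sharper bound [2 * s n], where the geometric sum [s n] stays below [1 / 4]. The
    bound is uniform in [n]: it controls the partial products and keeps them away from zero. *)
Lemma qpochn_near1 a n : normc a <= (1 - normc q) / 4 ->
  normc (qpochn q a n - 1) <= 2^-1.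
Proof.
move=> ha; have /andP[r0 r1] := r01.
pose s n := \sum_(i < n) normc a * normc q ^+ i.
have s4 m : s m <= 4^-1.
  have : (1 - normc q) * s m = normc a * (1 - normc q ^+ m).
    rewrite /s -mulr_sumr mulrCA; congr (_ * _).
    by have := subrX1 (normc q) m; lra.
  have h1 : 0 < 1 - normc q by lra.
  move=> e; rewrite -(ler_pM2l h1) e; apply: le_trans ha.
  by rewrite ler_piMr ?normc_ge0 // gerBl exprn_ge0.
suff : normc (qpochn q a n - 1) <= 2 * s n by have := s4 n; lra.
elim: n => [|n IH]; first by rewrite qpochn0 subrr normc0 /s big_ord0 mulr0.
have -> : qpochn q a n.+1 - 1 = (qpochn q a n - 1) + - (qpochn q a n * (a * q ^+ n)).
  by rewrite qpochnS; ring.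
apply: le_trans (le_normcD _ _) _.
have h2 : normc (qpochn q a n) <= 2.
  rewrite -[qpochn q a n](subrK 1); apply: le_trans (le_normcD _ _) _.
  by rewrite normc1; have := s4 n; lra.
rewrite normcN !normcM normcX /s big_ord_recr mulrDr /= lerD //.
by rewrite ler_wpM2r // mulr_ge0 ?exprn_ge0 ?normc_ge0.
Qed.

Lemma small_tail a : exists m, normc (a * q ^+ m) <= (1 - normc q) / 4.
Proof.
have /cvgC_normP/cvgr0Pnorm_le : cvgC (fun n => a * q ^+ n) 0.
  by rewrite -(mulr0 a); apply: cvgCM (cvgC_cst a) (cvgC_expr q1).
case/(_ ((1 - normc q) / 4)); first by have := q1; lra.
move=> m _ /(_ m (leqnn m)); rewrite /= subr0 ger0_norm ?normc_ge0 // => h.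
by exists m.
Qed.

(** After finitely many factors the argument is small; the partial products of the tail are then
    bounded by 2 and their increments are geometric. *)
Lemma cvg_qpochn a : cvgC (qpochn q a) (qpoch q a).
Proof.
suff [l hl] : exists l, cvgC (qpochn q a) l by rewrite /qpoch (cvgC_lim hl).
have [m hm] := small_tail a.
have [l hl] : exists l, cvgC (qpochn q (a * q ^+ m)) l.
  apply: (@cvgC_geometric_increments _ _ (2 * normc (a * q ^+ m)) _ r01) => n.
  have -> : qpochn q (a * q ^+ m) n.+1 - qpochn q (a * q ^+ m) n =
      - (qpochn q (a * q ^+ m) n * (a * q ^+ m * q ^+ n)).
    by rewrite qpochnS; ring.
  rewrite normcN normcM normcM normcX mulrA ler_wpM2r ?exprn_ge0 ?normc_ge0 //.
  rewrite ler_wpM2r ?normc_ge0 //.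
  rewrite -[qpochn _ _ n](subrK 1); apply: le_trans (le_normcD _ _) _.
  by rewrite normc1; have := qpochn_near1 n hm; lra.
exists (qpochn q a m * l); apply/(cvgC_shift m).
apply: (cvgC_eq _ (cvgCM (cvgC_cst (qpochn q a m)) hl)) => n.
by rewrite addnC qpochnD.
Qed.

Lemma qpochD a m : qpoch q a = qpochn q a m * qpoch q (a * q ^+ m).
Proof.
apply: cvgC_unique ((cvgC_shift m _ _).2 (cvg_qpochn a)) _.
apply: (cvgC_eq _ (cvgCM (cvgC_cst (qpochn q a m)) (cvg_qpochn (a * q ^+ m)))) => n.
by rewrite addnC qpochnD.
Qed.

Lemma qpochS a : qpoch q a = (1 - a) * qpoch q (a * q).
Proof. by rewrite (qpochD a 1) qpochnS qpochn0 mul1r expr0 mulr1 expr1. Qed.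

(** The truncations of a tail with small argument stay within [1 / 2] of 1, so the tail is nonzero
    and a zero must come from one of the first [m] factors. *)
Lemma qpoch_eq0P a : reflect (exists n, a * q ^+ n = 1) (qpoch q a == 0).
Proof.
apply: (iffP eqP) => [h|[n hn]]; last first.
  by rewrite (qpochD a n) (qpochS (a * _)) hn subrr mul0r mulr0.
have [m hm] := small_tail a.
have nz : qpoch q (a * q ^+ m) != 0.
  apply/eqP => e; have := cvg_qpochn (a * q ^+ m); rewrite e => /cvgC_normP.
  move=> /cvgr0Pnorm_le/(_ 4^-1) [|n _ /(_ n (leqnn n))]; first by rewrite invr_gt0.
  rewrite /= subr0 ger0_norm ?normc_ge0 // => h4.
  have := qpochn_near1 n hm; set P := qpochn _ _ _ in h4 *.
  have : normc (1 : R[i]) <= normc (P - 1) + normc P.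
    rewrite -[normc (P - 1)]normcN -[X in normc X <= _](subrK P).
    by rewrite opprB; exact: le_normcD.
  by rewrite normc1; lra.
have : qpochn q a m == 0.
  by move/eqP: h; rewrite (qpochD a m) mulf_eq0 (negPf nz) orbF.
rewrite prodf_seq_eq0 => /hasP[i _ /=]; rewrite subr_eq0 => /eqP e.
by exists i.
Qed.

End QPochhammer.

(** * The sum of residues in the limit of infinite products *)

Section ResidueSum.
Variables (R : realType) (q : R[i]).
Hypotheses (q0 : q != 0) (q1 : normc q < 1).

Lemma qexp_neq1 n : q ^+ n.+1 != 1.
Proof.
apply/eqP => /(congr1 (@normc R)); rewrite normcX normc1 => e.
have : normc q ^+ n.+1 < 1 by rewrite exprn_ilt1 ?normc_ge0.
by rewrite e ltxx.
Qed.

Lemma qpoch_qq_neq0 : qpoch q q != 0.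
Proof.
by apply/qpoch_eq0P => // -[n] /eqP; rewrite -exprS (negPf (qexp_neq1 n)).
Qed.

(** Limit of [sum_residues_finite]: for each [k] the inner sum is a Cauchy product of the convergent
    [res_left] and the summable [res_right]. The condition on [A j / A k] keeps the poles
    distinct. *)
Lemma sum_residues (I : finType) (A B : I -> R[i]) (P : {poly R[i]})
    (L : I -> R[i]) (C r : I -> R) :
  (forall k, A k != 0) -> (forall k, B k != 0) ->
  (forall j k, j != k -> qpoch q (A j / A k) != 0) ->
  (size P < #|I|)%N ->
  (forall k, 0 <= r k < 1) ->
  (forall k n, normc (res_right q A B P k n) <= C k * r k ^+ n) ->
  (forall k, cvgC (fun N => \sum_(n < N) res_right q A B P k n) (L k)) ->
  \sum_k (\prod_j qpoch q (A k / B j)) /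
    (\prod_(j | j != k) qpoch q (A k / A j)) * L k = 0.
Proof.
move=> A0 B0 AA sP r01 hC hL.
have qn0 n : q ^+ n != 0 by rewrite expf_neq0.
have ninj m n : q ^+ m = q ^+ n -> (m <= n)%N -> m = n.
  move=> e mn; move: e; rewrite -(subnKC mn) exprD -[LHS]mulr1 => /(mulfI (qn0 m)).
  case: (n - m)%N => [|d]; first by rewrite addn0.
  by move=> /esym/eqP; rewrite (negPf (qexp_neq1 d)).
(* A coincidence would give [A j / A k * q ^+ (n - m) = 1], a zero of a product assumed nonzero. *)
have Adist j k m n : j != k -> (m <= n)%N -> A j * q ^- m <> A k * q ^- n.
  move=> jk mn e; have /negP := AA _ _ jk; apply; apply/qpoch_eq0P => //.
  exists (n - m)%N; move: e; rewrite -{1}(subnK mn) exprD invfM mulrA.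
  move=> /(mulIf (invr_neq0 (qn0 m))) ->.
  by rewrite [A k / _]mulrC mulfK // mulVf.
have Ainj j k m n : A j * q ^- m = A k * q ^- n -> j = k /\ m = n.
  move=> e; have [jk|jk] := eqVneq j k; last first.
    case: (leqP m n) => [mn|/ltnW nm]; first by case: (Adist _ _ _ _ jk mn).
    by move: jk; rewrite eq_sym => jk; case: (Adist _ _ _ _ jk nm).
  split=> //; move: e; rewrite jk => /(mulfI (A0 k))/invr_inj e.
  by case: (leqP m n) => [/ninj->|/ltnW/ninj->].
have X0 k : qpoch q q * \prod_(j | j != k) qpoch q (A k / A j) != 0.
  rewrite mulf_neq0 ?qpoch_qq_neq0 //; apply/prodf_neq0 => j jk.
  by rewrite AA // eq_sym.
pose X k := (\prod_j qpoch q (A k / B j)) /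
  (qpoch q q * \prod_(j | j != k) qpoch q (A k / A j)).
have hX k : cvgC (res_left q A B k) (X k).
  apply: cvgCM; first by apply: cvgC_prod => j; exact: cvg_qpochn.
  apply: cvgCV => //; apply: cvgCM; first exact: cvg_qpochn.
  apply: cvgC_prod => j.
  apply: (cvgC_eq _ ((cvgC_shift 1 _ _).2 (cvg_qpochn q1 _))) => n.
  by rewrite addn1.
have H : cvgC (fun N : nat => \sum_k \sum_(n < N.+1)
    res_left q A B k (N - n) * res_right q A B P k n) (\sum_k X k * L k).
  by apply: cvgC_sum => k; exact: (cvgC_convolution (r01 k) (hX k) (hC k) (hL k)).
have {}H : \sum_k X k * L k = 0.
  apply: cvgC_unique H _; apply: (cvgC_eq _ (cvgC_cst 0)) => N.
  by rewrite sum_residues_finite.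
(* The factor [qpoch q q], due to the progression of the pole itself, is the same for all [k]. *)
apply: (mulfI (invr_neq0 qpoch_qq_neq0)); rewrite mulr0 -[RHS]H mulr_sumr.
apply: eq_bigr => k _; rewrite /X invfM.
by rewrite mulrA; congr (_ * _); rewrite mulrCA.
Qed.

End ResidueSum.

(** * Theta functions and the two residue identities *)

Section ThetaIdentities.
Variables (R : realType) (q : R[i]).
Hypotheses (q0 : q != 0) (q1 : normc q < 1).
Implicit Types x : R[i].

Lemma theta_reflect x : theta q (q / x) = theta q x.
Proof. by rewrite /theta invf_div mulrCA divff // mulr1 mulrC. Qed.

(** The shift removes [1 - x] from the first product and adds [1 - x^-1] to the second; the quotient
    of the two is [- x^-1]. *)
Lemma thetaMq x : x != 0 -> theta q (x * q) = - x^-1 * theta q x.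
Proof.
move=> x0; rewrite /theta.
have -> : q / (x * q) = x^-1 by rewrite invfM mulrCA divff // mulr1.
rewrite (qpochS q1 x) (qpochS q1 x^-1) [x^-1 * q]mulrC.
by move: (qpoch _ _) (qpoch _ _) => u v; field.
Qed.

Lemma theta_inv x : x != 0 -> theta q x^-1 = - x^-1 * theta q x.
Proof.
move=> x0; rewrite -thetaMq // -theta_reflect invrK mulrC //.
Qed.

Lemma theta_neq0l x : theta q x != 0 -> qpoch q x != 0.
Proof. by apply: contraNneq => h; rewrite /theta h mul0r. Qed.

Lemma theta_neq0r x : theta q x != 0 -> qpoch q (q / x) != 0.
Proof. by apply: contraNneq => h; rewrite /theta h mulr0. Qed.

Variables (I : finType) (a b : I -> R[i]).
Hypotheses (a0 : forall k, a k != 0) (b0 : forall k, b k != 0).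
Hypothesis aa : forall j k, j != k -> theta q (a j / a k) != 0.

Let qaa j k : qpoch q (q * a j / a k) != 0.
Proof.
have [->|jk] := eqVneq j k; first by rewrite mulfK ?qpoch_qq_neq0.
by have := theta_neq0r (aa (_ : k != j)); rewrite invf_div mulrA eq_sym; apply.
Qed.

Lemma geometric_bound (s w : nat -> R[i]) l :
  (forall n, s n = q ^+ n * w n) -> cvgC w l ->
  exists C : R, forall n, normc (s n) <= C * normc q ^+ n.
Proof.
move=> sw /cvgC_bounded[C HC]; exists C => n.
by rewrite sw normcM normcX mulrC ler_wpM2r // exprn_ge0 ?normc_ge0.
Qed.

(** The residue sum for [B j = b j / q] and the numerator with [u * P u = \prod_j (u - a j) -
    \prod_j (u - b j)]. The inner series telescopes, and the products left over combine with those
    of [sum_residues] into theta functions. *)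
Lemma sum_theta_ratio0 : (1 < #|I|)%N -> \prod_k a k = \prod_k b k ->
  \sum_k (\prod_j theta q (a k / b j)) /
    (\prod_(j | j != k) theta q (a k / a j)) = 0.
Proof.
move=> I1 ab.
have [P sP PE] := prod_XsubC_diff (ltnW I1) ab.
have qn0 n : q ^+ n != 0 by rewrite expf_neq0.
pose B j := b j / q.
have B0 j : B j != 0 by rewrite mulf_neq0 // invr_eq0.
have qB j : q * B j = b j by rewrite /B mulrC divfK.
pose U k n := \prod_j (qpochn q (b j / a k) n / qpochn q (q * a j / a k) n).
(* At [u = a k * q ^- n] the two products in [u * P u] yield [V k n] and [V k n.+1]. *)
pose V k n := U k n * \prod_j (1 - a j / a k * q ^+ n).
pose Ui k := \prod_j (qpoch q (b j / a k) / qpoch q (q * a j / a k)).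
have cU k : cvgC (U k) (Ui k).
  apply: cvgC_prod => j; apply: cvgCM; first exact: cvg_qpochn.
  by apply: cvgCV => //; exact: cvg_qpochn.
have cq : cvgC (fun n => q ^+ n) 0 by exact: cvgC_expr.
have cV k : cvgC (V k) (Ui k).
  have h1 : cvgC (fun n => \prod_j (1 - a j / a k * q ^+ n)) (\prod_(j : I) 1).
    apply: cvgC_prod => j.
    have := cvgCD (cvgC_cst 1) (cvgCM (cvgC_cst (- (a j / a k))) cq).
    by rewrite mulr0 addr0; apply: cvgC_eq => n; rewrite mulNr.
  by rewrite big1_eq in h1; rewrite -[Ui k]mulr1; exact: cvgCM (cU k) h1.
have SE k n : res_right q a B P k n = a k * q ^- n * P.[a k * q ^- n] *
    (q ^+ n) ^+ #|I| * U k n.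
  rewrite /res_right /U; congr (_ * _ * _); last first.
    by apply: eq_bigr => j _; rewrite qB.
  rewrite exprAC; congr (_ ^+ n).
  rewrite /B; under eq_bigr do rewrite invf_div mulrA.
  rewrite !big_split /= prodfV -ab mulrAC divff ?mul1r ?prodr_const //.
  by apply/prodf_neq0.
have SV k n : res_right q a B P k n = a k ^+ #|I| * (V k n - V k n.+1).
  have h (c : I -> R[i]) : (\prod_j (a k * q ^- n - c j)) * (q ^+ n) ^+ #|I| =
      a k ^+ #|I| * \prod_j (1 - c j / a k * q ^+ n).
    rewrite -!prodr_const -!big_split /=; apply: eq_bigr => j _.
    by rewrite mulrBl mulrBr divfK // mulr1 mulrA [a k * _]mulrC divfK.
  have VS : V k n.+1 = U k n * \prod_j (1 - b j / a k * q ^+ n).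
    rewrite /V /U -!big_split /=; apply: eq_bigr => j _.
    have nz : 1 - q * a j / a k * q ^+ n != 0.
      apply/eqP => /eqP; rewrite subr_eq0 => /eqP e.
      by have /negP := qaa j k; apply; apply/qpoch_eq0P => //; exists n.
    rewrite !qpochnS exprS.
    have -> : a j / a k * (q * q ^+ n) = q * a j / a k * q ^+ n by ring.
    by rewrite invfM mulrACA mulrA divfK.
  by rewrite SE PE mulrBl !h VS /V; ring.
have cX m : cvgC (fun n => (q ^+ n) ^+ m) (0 ^+ m).
  elim: m => [|m IH]; first exact: cvgC_cst.
  by rewrite exprS; apply: (cvgC_eq _ (cvgCM cq IH)) => n; rewrite exprS.
have hC' k : exists C : R, forall n,
    normc (res_right q a B P k n) <= C * normc q ^+ n.
  (* Only powers [i <= #|I| - 2] occur in [P], so [(q ^+ n) ^+ #|I|] compensates the negative powers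
     of [q ^+ n] and leaves at least one factor [q ^+ n]. *)
  have cw : cvgC (fun n => \sum_(i < #|I|.-1)
       P`_i * a k ^+ i.+1 * (q ^+ n) ^+ (#|I|.-2 - i))
     (\sum_(i < #|I|.-1) P`_i * a k ^+ i.+1 * 0 ^+ (#|I|.-2 - i)).
    by apply: cvgC_sum => i; apply: cvgCM (cvgC_cst _) (cX _).
  apply: geometric_bound (cvgCM cw (cU k)) => n.
  rewrite SE mulrA; congr (_ * _).
  rewrite (@horner_coef_wide _ #|I|.-1); last by rewrite -ltnS prednK // ltnW.
  rewrite !mulr_sumr mulr_suml; apply: eq_bigr => i _.
  have -> : (q ^+ n) ^+ #|I| =
      (q ^+ n) ^+ i * (q ^+ n) ^+ (#|I|.-2 - i) * (q ^+ n) ^+ 2.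
    by rewrite -!exprD; congr (_ ^+ _); have := ltn_ord i; lia.
  rewrite exprMn exprVn [a k ^+ i.+1]exprS.
  move: (q ^+ n) (qn0 n) => Q Q0; move: (Q ^+ i) (expf_neq0 i Q0) => Qi Qi0.
  by move: (Q ^+ (_ - _)) => Qm; field; rewrite Q0 Qi0.
have [C hC] := fin_all_exists hC'.
(* The factor [j = k] vanishes at [n = 0], so the partial sums have no contribution from the lower
   end. *)
have V0 k : V k 0%N = 0.
  by rewrite /V (bigD1 k) //= expr0 mulr1 divff // subrr mul0r mulr0.
have TV k N : \sum_(n < N) (V k n - V k n.+1) = - V k N.
  elim: N => [|N IH]; first by rewrite big_ord0 V0 oppr0.
  by rewrite big_ord_recr /= IH; ring.
have cL k :
    cvgC (fun N => \sum_(n < N) res_right q a B P k n) (- (a k ^+ #|I| * Ui k)).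
  have := cvgCM (cvgC_cst (- a k ^+ #|I|)) (cV k); rewrite mulNr.
  apply: cvgC_eq => N; under eq_bigr do rewrite SV.
  by rewrite -mulr_sumr TV mulrN mulNr.
have r01 (k : I) : 0 <= normc q < 1 by rewrite normc_ge0 q1.
have H := sum_residues q0 q1 a0 B0 (fun j k jk => theta_neq0l (aa jk)) sP r01
  hC cL.
(* The [- b j] come from inverting the theta arguments, [qpoch q q] from the factor [j = k] of
   [Ui k], and the outer sign from the telescoping. *)
pose c := - (\prod_j (- b j)) / qpoch q q.
have c0 : c != 0.
  rewrite mulf_neq0 ?invr_eq0 ?qpoch_qq_neq0 // oppr_eq0.
  by apply/prodf_neq0 => j _; rewrite oppr_eq0.
apply: (mulfI c0); rewrite mulr0 -[RHS]H mulr_sumr; apply: eq_bigr => k _.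
have th j : - b j * theta q (a k / b j) =
    a k * (qpoch q (a k / B j) * qpoch q (b j / a k)).
  rewrite -[a k / b j]invf_div theta_inv ?mulf_neq0 ?invr_eq0 // invf_div /theta.
  have -> : q / (b j / a k) = a k / B j by rewrite /B; field; rewrite q0 b0 a0.
  by move: (qpoch _ _) (qpoch _ _) => u v; field.
have thB : \prod_j (- b j) * \prod_j theta q (a k / b j) =
    a k ^+ #|I| * (\prod_j qpoch q (a k / B j) * \prod_j qpoch q (b j / a k)).
  by rewrite -prodr_const -!big_split /=; apply: eq_bigr => j _; exact: th.
have -> : \prod_(j | j != k) theta q (a k / a j) =
    \prod_(j | j != k) qpoch q (a k / a j) *
    \prod_(j | j != k) qpoch q (q * a j / a k).
  by rewrite -big_split; apply: eq_bigr => j _; rewrite /theta invf_div mulrA.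
have -> : Ui k = \prod_j qpoch q (b j / a k) *
    (qpoch q q * \prod_(j | j != k) qpoch q (q * a j / a k))^-1.
  rewrite /Ui big_split /= prodfV; congr (_ * _^-1).
  by rewrite (bigD1 k) //= mulfK.
have -> : c * (\prod_j theta q (a k / b j) /
    (\prod_(j | j != k) qpoch q (a k / a j) *
     \prod_(j | j != k) qpoch q (q * a j / a k))) =
   - (\prod_j (- b j) * \prod_j theta q (a k / b j)) / (qpoch q q *
     (\prod_(j | j != k) qpoch q (a k / a j) *
     \prod_(j | j != k) qpoch q (q * a j / a k))).
  by rewrite /c !invfM; ring.
rewrite thB !invfM.
move: (\prod_j qpoch _ _) (\prod_j qpoch _ _) (\prod_(j | _) qpoch _ _)^-1 => u v w.
by move: (\prod_(j | _) qpoch _ _)^-1 (qpoch q q)^-1 (_ ^+ _) => *; ring.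
Qed.

(** The residue sum for [P = 1], [A = a / q], [B = b / q]. The balancing condition gives
    [(q ^+ 2) ^+ n], which turns [q ^- n] into the weight [q ^+ n] of a Jackson sum; the finite
    products are the integrand at [q / a k * q ^+ n] divided by its value [Phi k] at [n = 0]. *)
Lemma sum_theta_jackson0 : (1 < #|I|)%N -> \prod_k a k = q ^+ 2 * \prod_k b k ->
  (forall j k, qpoch q (q * b j / a k) != 0) ->
  \sum_k a k ^+ 2 * (\prod_j theta q (a k / b j)) /
    (\prod_(j | j != k) theta q (a k / a j)) *
    jackson0 q (fun t => \prod_j (qpoch q (a j * t) / qpoch q (b j * t))) (q / a k)
  = 0.
Proof.
move=> I1 ab qba.
have qn0 n : q ^+ n != 0 by rewrite expf_neq0.
pose A j := a j / q; pose B j := b j / q.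
have A0 j : A j != 0 by rewrite mulf_neq0 // invr_eq0.
have B0 j : B j != 0 by rewrite mulf_neq0 // invr_eq0.
have AA j k : A j / A k = a j / a k by rewrite /A; field; rewrite q0 a0.
have AB j k : A j / B k = a j / b k by rewrite /A /B; field; rewrite q0 b0.
have qA j k : q * A j / A k = q * a j / a k by rewrite -mulrA AA mulrA.
have qB j k : q * B j / A k = q * b j / a k by rewrite /A /B; field; rewrite q0 a0.
pose U k n := \prod_j (qpochn q (q * b j / a k) n / qpochn q (q * a j / a k) n).
pose Ui k := \prod_j (qpoch q (q * b j / a k) / qpoch q (q * a j / a k)).
have cU k : cvgC (U k) (Ui k).
  apply: cvgC_prod => j; apply: cvgCM; first exact: cvg_qpochn.
  by apply: cvgCV => //; exact: cvg_qpochn.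
have SE k n : res_right q A B 1 k n = q ^+ n * (a k / q * U k n).
  rewrite /res_right hornerC mulr1.
  have -> : \prod_j (A j / B j) = q ^+ 2.
    under eq_bigr do rewrite AB.
    by rewrite big_split /= prodfV ab mulfK //; apply/prodf_neq0.
  rewrite (eq_bigr (fun j => qpochn q (q * b j / a k) n / qpochn q (q * a j / a k) n)).
    rewrite -/(U k n) exprAC expr2 /A.
    by move: (q ^+ n) (qn0 n) => Q Q0; field; rewrite Q0 q0.
  by move=> j _; rewrite qA qB.
have r01 (k : I) : 0 <= normc q < 1 by rewrite normc_ge0 q1.
have hC' k := geometric_bound (SE k) (cvgCM (cvgC_cst (a k / q)) (cU k)).
have [C hC] := fin_all_exists hC'.
have [L cL] := fin_all_exists (fun k => cvgC_series_geometric (r01 k) (hC k)).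
have AA0 j k : j != k -> qpoch q (A j / A k) != 0.
  by move=> jk; rewrite AA theta_neq0l // aa.
have sP : (size (1%R : {poly R[i]}) < #|I|)%N by rewrite size_polyC oner_eq0.
have H := sum_residues q0 q1 A0 B0 AA0 sP r01 hC cL.
pose Phi k := \prod_j (qpoch q (q * a j / a k) / qpoch q (q * b j / a k)).
have JE k : jackson0 q (fun t => \prod_j (qpoch q (a j * t) / qpoch q (b j * t)))
    (q / a k) = (1 - q) * (Phi k * (q / a k) ^+ 2 * L k).
  rewrite /jackson0; congr (_ * _); apply: cvgC_lim.
  apply: (cvgC_eq _ (cvgCM (cvgC_cst (Phi k * (q / a k) ^+ 2)) (cL k))) => N.
  rewrite mulr_sumr; apply: eq_bigr => n _.
  rewrite SE.
  have -> : \prod_j (qpoch q (a j * (q / a k * q ^+ n)) /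
      qpoch q (b j * (q / a k * q ^+ n))) = Phi k * U k n.
    rewrite /Phi /U -big_split; apply: eq_bigr => j _ /=.
    have := qaa j k; have := qba j k.
    rewrite (qpochD q1 (q * a j / a k) n) (qpochD q1 (q * b j / a k) n).
    have -> : a j * (q / a k * q ^+ n) = q * a j / a k * q ^+ n by ring.
    have -> : b j * (q / a k * q ^+ n) = q * b j / a k * q ^+ n by ring.
    rewrite !mulf_eq0 !negb_or => /andP[n1 n2] /andP[n3 n4].
    by field; rewrite n1 n2 n3.
  by field; rewrite q0 a0.
(* Here [1 - q] is the Jackson prefactor, [q ^+ 2] is [a k ^+ 2 * (q / a k) ^+ 2], and [qpoch q q]
   is the factor [j = k] in the numerator of [Phi k]. *)
pose c := (1 - q) * q ^+ 2 * qpoch q q.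
rewrite -[RHS](mulr0 c) -[in RHS]H mulr_sumr; apply: eq_bigr => k _.
rewrite JE /c.
under [X in _ = _ * (X / _ * _)]eq_bigr do rewrite AB.
under [X in _ = _ * (_ / X * _)]eq_bigr do rewrite AA.
have -> : \prod_(j | j != k) theta q (a k / a j) =
    \prod_(j | j != k) qpoch q (a k / a j) *
    \prod_(j | j != k) qpoch q (q * a j / a k).
  by rewrite -big_split; apply: eq_bigr => j _; rewrite /theta invf_div mulrA.
have -> : \prod_j theta q (a k / b j) =
    \prod_j qpoch q (a k / b j) * \prod_j qpoch q (q * b j / a k).
  by rewrite -big_split; apply: eq_bigr => j _; rewrite /theta invf_div mulrA.
have -> : Phi k = qpoch q q * (\prod_(j | j != k) qpoch q (q * a j / a k)) /
    \prod_j qpoch q (q * b j / a k).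
  rewrite /Phi big_split /= prodfV; congr (_ / _).
  by rewrite (bigD1 k) //= mulfK.
have n1 : \prod_j qpoch q (q * b j / a k) != 0 by apply/prodf_neq0.
have n2 : \prod_(j | j != k) qpoch q (q * a j / a k) != 0 by apply/prodf_neq0.
have n3 : \prod_(j | j != k) qpoch q (a k / a j) != 0.
  by apply/prodf_neq0 => j jk; rewrite theta_neq0l // aa // eq_sym.
by field; rewrite a0 n1 n2 n3.
Qed.

End ThetaIdentities.

(** * The four-term relation *)

Section JacksonShift.
Variables (R : realType) (q : R[i]).
Implicit Types (f : R[i] -> R[i]) (u : nat -> R[i]).

(** No convergence is assumed: both sequences have the same limits, so the choice made by [lim] is
    the same. *)
Lemma limC_shift u m : limC (fun n => u (n + m)%N) = limC u.
Proof.
have P1 l : (((fun n => u (n + m)%N) : nat -> R[i]^o) @ \oo --> (l : R[i]^o)) =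
    ((u : nat -> R[i]^o) @ \oo --> (l : R[i]^o)).
  by apply/propext; rewrite (cvg_shiftn m (u : nat -> R[i]^o)).
have E : (fun l : R[i]^o => ((fun n => u (n + m)%N) : nat -> R[i]^o) @ \oo --> l) =
    (fun l : R[i]^o => (u : nat -> R[i]^o) @ \oo --> l).
  by apply/funext => l; exact: P1.
exact: (f_equal (fun P : set R[i]^o => get P) E).
Qed.

Lemma jackson0_shift f tau n : (forall i, (i < n)%N -> f (tau * q ^+ i) = 0) ->
  jackson0 q f tau = jackson0 q f (tau * q ^+ n).
Proof.
move=> f0; rewrite /jackson0; congr (_ * _).
rewrite -(limC_shift _ n); congr limC; apply/funext => N.
rewrite addnC big_split_ord /= big1 ?add0r => [|i _]; last by rewrite f0 ?mul0r.
by apply: eq_bigr => i _; rewrite exprD !mulrA.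
Qed.

End JacksonShift.

Lemma subn_predK m k : (k < m)%N -> m = ((m.-1 - k) + k).+1.
Proof. by case: m => // m km; rewrite subnK. Qed.

(** Makes four separate parameters a family over a finite type, to which the identities above
    apply. *)
Definition quad (T : nmodType) (x y z w : T) (i : 'I_4) : T :=
  [:: x; y; z; w]`_i.

Lemma quad_neq0 (T : nmodType) (x y z w : T) : x != 0 -> y != 0 -> z != 0 -> w != 0 ->
  forall i, quad x y z w i != 0.
Proof. by move=> ? ? ? ? [[|[|[|[|]]]]]. Qed.

Lemma quad_offdiag (T : nmodType) (P : T -> T -> Prop) (x y z w : T) :
  P x y -> P x z -> P x w -> P y x -> P y z -> P y w ->
  P z x -> P z y -> P z w -> P w x -> P w y -> P w z ->
  forall i j, i != j -> P (quad x y z w i) (quad x y z w j).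
Proof.
move=> ? ? ? ? ? ? ? ? ? ? ? ? [i hi] [j hj].
by case: i hi => [|[|[|[|i]]]] hi //; case: j hj => [|[|[|[|j]]]] hj.
Qed.

(** * Connection coefficients as quotients of residue weights *)

Section Coefficients.
Variables (R : realType) (q : R[i]).
Hypotheses (q0 : q != 0) (q1 : normc q < 1).

(* Up to a factor independent of [c1], the residue at [s = c1^-1] of
   [s ^- 3 * \prod_j (theta q (d_j * s) / theta q (c_j * s))]. *)
Definition residue_weight (c1 c2 c3 c4 d1 d2 d3 d4 : R[i]) : R[i] :=
  c1 ^+ 2 * (theta q (c1 / d1) * theta q (c1 / d2) * theta q (c1 / d3) *
    theta q (c1 / d4))
  / (theta q (c1 / c2) * theta q (c1 / c3) * theta q (c1 / c4)).

(** For [c_j = a_j] and [d_j = b_j], here and in [connection_den], the arguments are those of the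
    theta functions in [C_1], in the same order. *)
Definition connection_num (c1 c2 c3 c4 d1 d2 d3 d4 : R[i]) : R[i] :=
  thetas q [:: c1 / d1; c1 / d2; c1 / d3; d4 * q * q / c1; c4 / c2; c4 / c3].

Definition connection_den (c1 c2 c3 c4 d1 d2 d3 d4 : R[i]) : R[i] :=
  thetas q [:: c4 / d4 / q; c1 / c2; c1 / c3; c4 / d1; c4 / d2; c4 / d3].

(** This is [C_1 = - V_1 / V_4]. Removing the shifts by [q] gives the monomial [c1 / c4], inverting
    [c1 / c4] gives another and the sign; they account for the squares in the weights. *)
Lemma connection_residue_weight (c1 c2 c3 c4 d1 d2 d3 d4 : R[i]) :
  c1 != 0 -> c4 != 0 -> d4 != 0 ->
  theta q (c4 / c1) != 0 -> theta q (c4 / c2) != 0 -> theta q (c4 / c3) != 0 ->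
  connection_den c1 c2 c3 c4 d1 d2 d3 d4 != 0 ->
  connection_num c1 c2 c3 c4 d1 d2 d3 d4 /
    connection_den c1 c2 c3 c4 d1 d2 d3 d4 *
    residue_weight c4 c1 c2 c3 d1 d2 d3 d4 =
  - residue_weight c1 c2 c3 c4 d1 d2 d3 d4.
Proof.
move=> c10 c40 d40 n1 n2 n3.
have -> : connection_den c1 c2 c3 c4 d1 d2 d3 d4 =
    - (c4 / d4 / q) * theta q (c4 / d4) *
    theta q (c1 / c2) * theta q (c1 / c3) *
    theta q (c4 / d1) * theta q (c4 / d2) * theta q (c4 / d3).
  rewrite /connection_den /thetas !big_cons big_nil mulr1.
  rewrite -[X in - (_) * theta q X](divfK q0) thetaMq ?mulf_neq0 ?invr_eq0 //.
  by field; rewrite q0 c40 d40.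
have -> : connection_num c1 c2 c3 c4 d1 d2 d3 d4 =
    - (c1 / d4 / q) * theta q (c1 / d4) *
    theta q (c1 / d1) * theta q (c1 / d2) * theta q (c1 / d3) *
    theta q (c4 / c2) * theta q (c4 / c3).
  rewrite /connection_num /thetas !big_cons big_nil mulr1.
  have -> : d4 * q * q / c1 = q / (c1 / d4 / q) by field; rewrite q0 c10 d40.
  rewrite theta_reflect // -[X in - (_) * theta q X](divfK q0).
  rewrite thetaMq ?mulf_neq0 ?invr_eq0 //.
  by field; rewrite q0 c10 d40.
have e14 : theta q (c1 / c4) = - (c1 / c4) * theta q (c4 / c1).
  by rewrite -[c1 / c4]invf_div theta_inv ?mulf_neq0 ?invr_eq0 // invf_div.
rewrite /residue_weight e14; move: (theta q) n1 n2 n3 => T n1 n2 n3.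
rewrite !mulf_eq0 !negb_or.
move=> /andP[/andP[/andP[/andP[/andP[/andP[n4 n5] n6] n7] n8] n9] n10].
by field; rewrite q0 c10 c40 d40 n1 n2 n3 n5 n6 n7 n8 n9 n10.
Qed.

End Coefficients.

(** * The two vanishing sums for four parameters *)

Section FourTermRelation.
Variables (R : realType) (q : R[i]).
Hypotheses (q0 : q != 0) (q1 : normc q < 1).
Variables a1 a2 a3 a4 b1 b2 b3 b4 : R[i].

Definition integrand4 (t : R[i]) : R[i] :=
  qpochs q [:: a4 * t; a1 * t; a2 * t; a3 * t] /
  qpochs q [:: b4 * t; b1 * t; b2 * t; b3 * t].

Hypotheses (a10 : a1 != 0) (a20 : a2 != 0) (a30 : a3 != 0) (a40 : a4 != 0).
Hypotheses (b10 : b1 != 0) (b20 : b2 != 0) (b30 : b3 != 0) (b40 : b4 != 0).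
Hypothesis ab : a1 * a2 * a3 * a4 = q ^+ 2 * (b1 * b2 * b3 * b4).

Hypothesis aa : forall i j, i != j ->
  theta q (quad a1 a2 a3 a4 i / quad a1 a2 a3 a4 j) != 0.

(** Replacing [b4] by [b4 * q * q] restores the balance required by [sum_theta_ratio0]; by
    quasi-periodicity this costs the factor [a ^+ 2] of the weights and a common constant. *)
Lemma sum_residue_weight0 :
  residue_weight q a1 a2 a3 a4 b1 b2 b3 b4 +
  residue_weight q a2 a1 a3 a4 b1 b2 b3 b4 +
  residue_weight q a3 a1 a2 a4 b1 b2 b3 b4 +
  residue_weight q a4 a1 a2 a3 b1 b2 b3 b4 = 0.
Proof.
have h : \prod_i quad a1 a2 a3 a4 i = \prod_i quad b1 b2 b3 (b4 * q * q) i.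
  rewrite !big_ord_recl !big_ord0 /quad /= !mulr1 !mulrA ab; ring.
have I1 : (1 < #|'I_4|)%N by rewrite card_ord.
have B0 : forall i, quad b1 b2 b3 (b4 * q * q) i != 0.
  by apply: quad_neq0 => //; rewrite !mulf_neq0.
have := sum_theta_ratio0 q0 q1 (quad_neq0 a10 a20 a30 a40) B0 aa I1 h.
rewrite !big_ord_recl !big_ord0 /=.
do ![rewrite big_mkcond !big_ord_recl big_ord0 /=].
rewrite /quad /= => H.
have th a : a != 0 -> theta q (a / (b4 * q * q)) =
    q ^- 3 * b4 ^- 2 * (a ^+ 2 * theta q (a / b4)).
  move=> a0.
  have c0 : a / (b4 * q * q) != 0 by rewrite mulf_neq0 ?invr_eq0 ?mulf_neq0.
  have -> : a / b4 = a / (b4 * q * q) * q * q by field; rewrite q0 b40.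
  rewrite !thetaMq ?mulf_neq0 ?invr_eq0 ?mulf_neq0 //.
  move: (theta q _) => T.
  by field; rewrite q0 a0 b40.
rewrite !th // in H.
have c0 : q ^- 3 * b4 ^- 2 != 0 by rewrite mulf_neq0 ?invr_eq0 ?expf_neq0.
apply: (mulfI c0); rewrite mulr0 -[RHS]H /residue_weight {H c0 th}.
by move: (theta q) => T; rewrite !invfM invr1; ring.
Qed.

Lemma sum_residue_weight_jackson0 :
  (forall i j,
    qpoch q (q * quad b1 b2 b3 b4 j / quad a1 a2 a3 a4 i) != 0) ->
  residue_weight q a1 a2 a3 a4 b1 b2 b3 b4 * jackson0 q integrand4 (q / a1) +
  residue_weight q a2 a1 a3 a4 b1 b2 b3 b4 * jackson0 q integrand4 (q / a2) +
  residue_weight q a3 a1 a2 a4 b1 b2 b3 b4 * jackson0 q integrand4 (q / a3) +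
  residue_weight q a4 a1 a2 a3 b1 b2 b3 b4 * jackson0 q integrand4 (q / a4) = 0.
Proof.
move=> qba.
have h : \prod_i quad a1 a2 a3 a4 i = q ^+ 2 * \prod_i quad b1 b2 b3 b4 i.
  rewrite !big_ord_recl !big_ord0 /quad /= !mulr1 !mulrA ab; ring.
have I1 : (1 < #|'I_4|)%N by rewrite card_ord.
have B0 := quad_neq0 b10 b20 b30 b40.
have := sum_theta_jackson0 q0 q1 (quad_neq0 a10 a20 a30 a40) B0 aa I1 h
  (fun j k => qba k j).
have -> : (fun t => \prod_j (qpoch q (quad a1 a2 a3 a4 j * t) /
    qpoch q (quad b1 b2 b3 b4 j * t))) = integrand4.
  apply/funext => t; rewrite !big_ord_recl big_ord0 /integrand4 /qpochs !big_cons !big_nil.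
  by rewrite /quad /= !mulr1 !invfM; ring.
rewrite !big_ord_recl !big_ord0 /=.
do ![rewrite big_mkcond !big_ord_recl big_ord0 /=].
rewrite /quad /= => H.
rewrite -[RHS]H /residue_weight {H}.
by move: (theta q) (jackson0 _ _) => T J; rewrite !invfM invr1; ring.
Qed.

Lemma integrand4_eq0 c t n : c \in [:: a4; a1; a2; a3] ->
  c * t * q ^+ n = 1 -> integrand4 t = 0.
Proof.
move=> cs e; rewrite /integrand4 /qpochs; apply/eqP; rewrite mulf_eq0; apply/orP; left.
rewrite prodf_seq_eq0; apply/hasP; exists (c * t).
  by move: cs; rewrite !inE => /or4P[] /eqP ->; rewrite eqxx ?orbT.
by apply/qpoch_eq0P => //; exists n.
Qed.

Lemma jackson0_zero c : c \in [:: a4; a1; a2; a3] -> c != 0 ->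
  jackson0 q integrand4 c^-1 = jackson0 q integrand4 (q / c).
Proof.
move=> cs c0; rewrite (@jackson0_shift _ _ _ _ 1) ?expr1 1?mulrC // => i.
rewrite ltnS leqn0 => /eqP ->; rewrite expr0 mulr1.
by apply: (@integrand4_eq0 c _ 0) => //; rewrite expr0 mulr1 divff.
Qed.

(** A zero of theta puts [c] and [d] in one [q]-progression. The two sums then differ by finitely
    many initial terms, at which the integrand vanishes. *)
Lemma jackson0_theta_eq0 c d : c \in [:: a4; a1; a2; a3] ->
  d \in [:: a4; a1; a2; a3] -> c != 0 -> d != 0 -> theta q (c / d) = 0 ->
  jackson0 q integrand4 (q / c) = jackson0 q integrand4 (q / d).
Proof.
have qn0 n : q ^+ n != 0 by rewrite expf_neq0.
have key x y n : x \in [:: a4; a1; a2; a3] -> x != 0 -> y = x * q ^+ n ->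
    jackson0 q integrand4 (q / x) = jackson0 q integrand4 (q / y).
  move=> xs x0 ->; rewrite [RHS](@jackson0_shift _ _ _ _ n) => [|i ni].
    by rewrite invfM mulrA divfK.
  (* At the [i]-th skipped point the argument [x * t] equals [q ^- (n.-1 - i)]. *)
  apply: (@integrand4_eq0 x _ (n.-1 - i)) => //.
  have -> : n = ((n.-1 - i) + i).+1 by exact: subn_predK.
  rewrite exprS exprD -pred_Sn addnK.
  by field; rewrite q0 x0 !qn0.
move=> cs ds c0 d0 /eqP; rewrite mulf_eq0 => /orP[] /(qpoch_eq0P q1)[n e].
  apply: (key c d n cs c0); apply: (mulfI (invr_neq0 d0)).
  by rewrite mulVf // mulrA [_^-1 * c]mulrC e.
apply/esym; apply: (key d c n.+1 ds d0).
have <- : q / (c / d) * q ^+ n * c = d * q ^+ n.+1.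
  by rewrite exprS; field; rewrite c0 d0.
by rewrite e mul1r.
Qed.

End FourTermRelation.

Lemma connection_relation (R : realType) (q a1 a2 a3 a4 b1 b2 b3 b4 : R[i]) :
  q != 0 -> normc q < 1 ->
  a1 != 0 -> a2 != 0 -> a3 != 0 -> a4 != 0 ->
  b1 != 0 -> b2 != 0 -> b3 != 0 -> b4 != 0 ->
  a1 * a2 * a3 * a4 = q ^+ 2 * (b1 * b2 * b3 * b4) ->
  connection_den q a1 a2 a3 a4 b1 b2 b3 b4 != 0 ->
  connection_den q a2 a1 a3 a4 b2 b1 b3 b4 != 0 ->
  connection_den q a3 a2 a1 a4 b3 b2 b1 b4 != 0 ->
  (forall i j, qpoch q (q * quad b1 b2 b3 b4 j / quad a1 a2 a3 a4 i) != 0) ->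
  let J := jackson0 q (integrand4 q a1 a2 a3 a4 b1 b2 b3 b4) in
  connection_num q a1 a2 a3 a4 b1 b2 b3 b4 /
    connection_den q a1 a2 a3 a4 b1 b2 b3 b4 *
    (J (q / a4) - J a1^-1) +
  connection_num q a2 a1 a3 a4 b2 b1 b3 b4 /
    connection_den q a2 a1 a3 a4 b2 b1 b3 b4 *
    (J (q / a4) - J a2^-1) +
  connection_num q a3 a2 a1 a4 b3 b2 b1 b4 /
    connection_den q a3 a2 a1 a4 b3 b2 b1 b4 *
    (J (q / a4) - J a3^-1) = 0.
Proof.
move=> q0 q1 a10 a20 a30 a40 b10 b20 b30 b40 ab D1 D2 D3 qba J.
have m1 : a1 \in [:: a4; a1; a2; a3] by rewrite !inE eqxx ?orbT.
have m2 : a2 \in [:: a4; a1; a2; a3] by rewrite !inE eqxx ?orbT.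
have m3 : a3 \in [:: a4; a1; a2; a3] by rewrite !inE eqxx ?orbT.
have m4 : a4 \in [:: a4; a1; a2; a3] by rewrite !inE eqxx ?orbT.
rewrite /J !jackson0_zero //.
have z41 : theta q (a4 / a1) = 0 -> J (q / a4) - J (q / a1) = 0.
  by move=> z; apply/eqP; rewrite subr_eq0; apply/eqP;
    apply: jackson0_theta_eq0.
have z42 : theta q (a4 / a2) = 0 -> J (q / a4) - J (q / a2) = 0.
  by move=> z; apply/eqP; rewrite subr_eq0; apply/eqP;
    apply: jackson0_theta_eq0.
have z43 : theta q (a4 / a3) = 0 -> J (q / a4) - J (q / a3) = 0.
  by move=> z; apply/eqP; rewrite subr_eq0; apply/eqP;
    apply: jackson0_theta_eq0.
have C0 x y z w r s t v : (theta q (w / y) = 0 \/ theta q (w / z) = 0) ->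
    connection_num q x y z w r s t v = 0.
  rewrite /connection_num /thetas !big_cons => -[] ->; rewrite ?(mul0r, mulr0) //.
have [e41|n41] := eqVneq (theta q (a4 / a1)) 0.
  rewrite -/J z41 // mulr0 !C0 ?mul0r ?addr0 //; by [left | right].
have [e42|n42] := eqVneq (theta q (a4 / a2)) 0.
  rewrite -/J z42 // mulr0 !C0 ?mul0r ?addr0 //; by [left | right].
have [e43|n43] := eqVneq (theta q (a4 / a3)) 0.
  rewrite -/J z43 // mulr0 !C0 ?mul0r ?addr0 //; by [left | right].
rewrite -/J.
(* Ratios among [a1], [a2], [a3] are covered by the denominators, ratios with [a4] by the cases
   excluded above and inversion. *)
have aa : forall i j, i != j ->
    theta q (quad a1 a2 a3 a4 i / quad a1 a2 a3 a4 j) != 0.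
  have ti c d : c != 0 -> d != 0 -> theta q (c / d) != 0 -> theta q (d / c) != 0.
    move=> c0 d0 h; rewrite -[d / c]invf_div.
    have cd0 : c / d != 0 by rewrite mulf_neq0 ?invr_eq0.
    by rewrite theta_inv //; apply: mulf_neq0 => //; rewrite oppr_eq0 invr_eq0.
  have d2 x y z w r s t v : connection_den q x y z w r s t v != 0 ->
      theta q (x / y) != 0 /\ theta q (x / z) != 0.
    rewrite /connection_den /thetas !big_cons big_nil; move: (theta q) => T.
    by rewrite !mulf_eq0 !negb_or => /and3P[_ -> /andP[-> _]].
  have [n12 n13] := d2 _ _ _ _ _ _ _ _ D1.
  have [n21 n23] := d2 _ _ _ _ _ _ _ _ D2.
  have [n32 n31] := d2 _ _ _ _ _ _ _ _ D3.
  apply: (@quad_offdiag _ (fun c d => theta q (c / d) != 0)) => //; exact: ti.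
have H0 := sum_residue_weight0 q0 q1 a10 a20 a30 a40 b10 b20 b30 b40 ab aa.
have HJ := sum_residue_weight_jackson0 q0 q1 a10 a20 a30 a40 b10 b20 b30 b40
  ab aa qba.
rewrite -/J in HJ.
(* All theta factors above occur in the denominator [D1], the one at [a4 / b4] after a shift by
   [q]. *)
have W40 : residue_weight q a4 a1 a2 a3 b1 b2 b3 b4 != 0.
  have y0 : a4 / b4 / q != 0 by rewrite !mulf_eq0 !invr_eq0 !negb_or a40 b40.
  have e : theta q (a4 / b4) = - (a4 / b4 / q)^-1 * theta q (a4 / b4 / q).
    by rewrite -thetaMq // divfK.
  have s0 : - (a4 / b4 / q)^-1 != 0 by rewrite oppr_eq0 invr_eq0.
  move: D1 n41 n42 n43; rewrite /connection_den /residue_weight /thetas !big_cons big_nil e.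
  move: s0 (theta q); move: (- _) => c c0 T.
  rewrite !mulf_eq0 !negb_or => /and5P[h1 h2 h3 h4 /and3P[h5 h6 _]] n1 n2 n3.
  by rewrite invr_eq0 !mulf_eq0 !negb_or a40 c0 h1 h4 h5 h6 n1 n2 n3.
have E1 := connection_residue_weight q0 q1 a10 a40 b40 n41 n42 n43 D1.
have E2 := connection_residue_weight q0 q1 a20 a40 b40 n42 n41 n43 D2.
have E3 := connection_residue_weight q0 q1 a30 a40 b40 n43 n42 n41 D3.
(* The exchanges defining [C_2] and [C_3] only permute factors of the weights. *)
have V2 : residue_weight q a4 a2 a1 a3 b2 b1 b3 b4 =
    residue_weight q a4 a1 a2 a3 b1 b2 b3 b4.
  by rewrite /residue_weight; move: (theta q) => T; rewrite !invfM; ring.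
have V3 : residue_weight q a4 a3 a2 a1 b3 b2 b1 b4 =
    residue_weight q a4 a1 a2 a3 b1 b2 b3 b4.
  by rewrite /residue_weight; move: (theta q) => T; rewrite !invfM; ring.
have V2' : residue_weight q a2 a1 a3 a4 b2 b1 b3 b4 =
    residue_weight q a2 a1 a3 a4 b1 b2 b3 b4.
  by rewrite /residue_weight; move: (theta q) => T; rewrite !invfM; ring.
have V3' : residue_weight q a3 a2 a1 a4 b3 b2 b1 b4 =
    residue_weight q a3 a1 a2 a4 b1 b2 b3 b4.
  by rewrite /residue_weight; move: (theta q) => T; rewrite !invfM; ring.
rewrite V2 V2' in E2; rewrite V3 V3' in E3.
apply: (mulIf W40); rewrite mul0r.
rewrite !mulrDl ![_ * (J _ - _) * _]mulrAC E1 E2 E3.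
move: H0 HJ; move: (residue_weight _ _ _ _ _ _ _ _ _)
  (residue_weight _ _ _ _ _ _ _ _ _) => v2 v1.
move: (residue_weight _ _ _ _ _ _ _ _ _)
  (residue_weight _ _ _ _ _ _ _ _ _) => v4 v3 H0 HJ.
(* Subtracting [J (q / a4)] times the first relation from the second removes the terms with [v4]. *)
have e : 0 = (v1 * J (q / a1) + v2 * J (q / a2) + v3 * J (q / a3) + v4 * J (q / a4))
   - J (q / a4) * (v1 + v2 + v3 + v4) by rewrite H0 HJ mulr0 subr0.
by rewrite [RHS]e; ring.
Qed.

(** * Laws of complex powers *)

Section ComplexPower.
Variables (R : realType) (loga : R[i]).

Lemma cexpD (z w : R[i]) : cexp (z + w) = cexp z * cexp w.
Proof.
case: z w => a b [c d]; rewrite /cexp /= expRD cosD sinD.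
by apply/eqP; rewrite eq_complex /=; apply/andP; split; apply/eqP; ring.
Qed.

Lemma cexp0 : cexp 0 = 1 :> R[i].
Proof.
rewrite /cexp /= expR0 cos0 sin0.
by apply/eqP; rewrite eq_complex /=; apply/andP; split; apply/eqP; ring.
Qed.

Lemma cpowD (c d : R[i]) : cpow loga (c + d) = cpow loga c * cpow loga d.
Proof. by rewrite /cpow mulrDl cexpD. Qed.

Lemma cpow_neq0 (c : R[i]) : cpow loga c != 0.
Proof.
apply/eqP => e; have : cpow loga (c - c) = 1 by rewrite subrr /cpow mul0r cexp0.
by rewrite cpowD e mul0r => /esym/eqP; rewrite oner_eq0.
Qed.

Lemma cpowN (c : R[i]) : cpow loga (- c) = (cpow loga c)^-1.
Proof.
apply: (mulfI (cpow_neq0 c)); rewrite divff ?cpow_neq0 // -cpowD subrr.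
by rewrite /cpow mul0r cexp0.
Qed.

End ComplexPower.

(** * Translation of the original parameters *)

Theorem corollary3p8 (R : realType)
    (q logq h1 h2 h3 l1 l2 l3 nu alpha t1 t2 t3 x logx : R[i])
    (hq : 0 < `|q| < 1) (hlogq : cexp logq = q)
    (ht1 : t1 != 0) (ht2 : t2 != 0) (ht3 : t3 != 0)
    (hx : x != 0) (hlogx : cexp logx = x)
    (hnu : cpow logq (2 * nu) = cpow logq (h1 + h2 + h3 - l1 - l2 - l3 + 1))
    (hC1 : C_den q logq nu x h1 h2 h3 l1 l2 l3 t1 t2 t3 != 0)
    (hC2 : C_den q logq nu x h2 h1 h3 l2 l1 l3 t2 t1 t3 != 0)
    (hC3 : C_den q logq nu x h3 h2 h1 l3 l2 l1 t3 t2 t1 != 0)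
    (hden : forall i n : nat, (1 <= i <= 4)%N ->
       H3_den q logq nu x l1 l2 l3 t1 t2 t3
         (H3_tau logq nu x h1 h2 h3 t1 t2 t3 i * q ^+ n) != 0) :
  let C1 := C_coef q logq nu x h1 h2 h3 l1 l2 l3 t1 t2 t3 in
  let C2 := C_coef q logq nu x h2 h1 h3 l2 l1 l3 t2 t1 t3 in
  let C3 := C_coef q logq nu x h3 h2 h1 l3 l2 l1 t3 t2 t1 in
  let phi := phi_H3 q logq logx nu alpha x h1 h2 h3 l1 l2 l3 t1 t2 t3 in
  C1 * phi 1%N 4%N + C2 * phi 2%N 4%N + C3 * phi 3%N 4%N = 0.
Proof.
have /andP[nq0 nq1] := hq.
have q0 : q != 0 by rewrite -normr_gt0.
have q1 : normc q < 1 by rewrite -ltcR -normr_normc.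
(* Makes [cpow logq] opaque, so that [field] treats its values as atoms governed by the exponent
   laws alone. *)
have [E eE] : exists E, cpow logq = E by exists (cpow logq).
have ED c d : E (c + d) = E c * E d by rewrite -eE cpowD.
have EN c : E (- c) = (E c)^-1 by rewrite -eE cpowN.
have E0 c : E c != 0 by rewrite -eE cpow_neq0.
have E1 : E 1 = q by rewrite -eE /cpow mul1r.
have E32 : E (3 / 2) = q * E (1 / 2).
  by rewrite -E1 -ED; congr E; field.
have Es : q = E (1 / 2) ^+ 2.
  by rewrite -E1 expr2 -ED; congr E; field.
pose a (h t : R[i]) := E h * E (1 / 2) * t.
pose b (l t : R[i]) := E nu * E l / E (1 / 2) * t.
pose a4 := E nu * x.
have a0 h t : t != 0 -> a h t != 0 by move=> t0; rewrite !mulf_neq0 ?E0.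
have b0 l t : t != 0 -> b l t != 0 by move=> t0; rewrite !mulf_neq0 ?invr_eq0 ?E0.
have a40 : a4 != 0 by rewrite mulf_neq0 ?E0.
have ab : a h1 t1 * a h2 t2 * a h3 t3 * a4 =
    q ^+ 2 * (b l1 t1 * b l2 t2 * b l3 t3 * x).
  (* The condition on [nu], with every exponent split into a product of powers. *)
  have : E nu ^+ 2 * E l1 * E l2 * E l3 = E h1 * E h2 * E h3 * q.
    move: hnu; rewrite eE (_ : 2 * nu = nu + nu); last by ring.
    rewrite !ED !EN E1 -expr2 => ->.
    by field; rewrite !E0.
  move=> h; rewrite /a /b /a4.
  have -> : q ^+ 2 = E (1 / 2) ^+ 3 * E (1 / 2) by rewrite {1}Es -!exprM -exprSr.
  rewrite Es in h.
  have s0 := E0 (1 / 2); move: (E (1 / 2)) s0 h => s s0 h.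
  transitivity (s * E nu * (t1 * t2 * t3 * x) * (E h1 * E h2 * E h3 * s ^+ 2)).
    by ring.
  by rewrite -h; field; rewrite s0.
have numE k1 k2 k3 m1 m2 m3 u1 u2 u3 : u1 != 0 -> u2 != 0 -> u3 != 0 ->
    C_num q logq nu x k1 k2 k3 m1 m2 m3 u1 u2 u3 =
    connection_num q (a k1 u1) (a k2 u2) (a k3 u3) a4 (b m1 u1) (b m2 u2) (b m3 u3) x.
  move=> u10 u20 u30; rewrite /C_num /connection_num; congr (thetas q _).
  rewrite eE !ED !EN E1 E32 /a /b /a4 Es.
  by congr [:: _; _; _; _; _; _]; field; rewrite !E0 ?u10 ?u20 ?u30 ?hx.
have denE k1 k2 k3 m1 m2 m3 u1 u2 u3 : u1 != 0 -> u2 != 0 -> u3 != 0 ->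
    C_den q logq nu x k1 k2 k3 m1 m2 m3 u1 u2 u3 =
    connection_den q (a k1 u1) (a k2 u2) (a k3 u3) a4 (b m1 u1) (b m2 u2) (b m3 u3) x.
  move=> u10 u20 u30; rewrite /C_den /connection_den; congr (thetas q _).
  rewrite eE !ED !EN E1 /a /b /a4 Es.
  by congr [:: _; _; _; _; _; _]; field; rewrite !E0 ?u10 ?u20 ?u30 ?hx.
have H3_denE t : H3_den q logq nu x l1 l2 l3 t1 t2 t3 t =
    qpochs q [:: x * t; b l1 t1 * t; b l2 t2 * t; b l3 t3 * t].
  by rewrite /H3_den eE !ED !EN.
have fE : (fun t => H3_num q logq nu x h1 h2 h3 t1 t2 t3 t /
      H3_den q logq nu x l1 l2 l3 t1 t2 t3 t) =
    integrand4 q (a h1 t1) (a h2 t2) (a h3 t3) a4 (b l1 t1) (b l2 t2) (b l3 t3) x.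
  apply/funext => t; rewrite /H3_num H3_denE /integrand4 eE.
  by congr (qpochs q _ / _); rewrite !ED.
have tauE k u : E (- k - 1 / 2) / u = (a k u)^-1.
  by rewrite ED !EN /a !invfM.
have tau4E : E (1 - nu) / x = q / a4.
  by rewrite ED EN E1 /a4 invfM mulrA.
have qba i j : qpoch q (q * quad (b l1 t1) (b l2 t2) (b l3 t3) x j /
   quad (a h1 t1) (a h2 t2) (a h3 t3) a4 i) != 0.
  have key t : H3_den q logq nu x l1 l2 l3 t1 t2 t3 t != 0 ->
      forall j, qpoch q (quad (b l1 t1) (b l2 t2) (b l3 t3) x j * t) != 0.
    rewrite H3_denE /qpochs !big_cons big_nil !mulf_eq0 !negb_or.
    move=> /and5P[n4 n1 n2 n3 _] [[|[|[|[|k]]]] hk] //.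
  have {key} key n m : (0 < m <= 4)%N -> forall j,
      qpoch q (quad (b l1 t1) (b l2 t2) (b l3 t3) x j *
       (H3_tau logq nu x h1 h2 h3 t1 t2 t3 m * q ^+ n)) != 0.
    by move=> hm; apply: key; exact: hden.
  (* Since [tau_i] is [1 / a_i] for [i <= 3], the point [q / a_i] is the term [n = 1] of the
     genericity hypothesis; [tau_4 = q / a_4] is the term [n = 0]. *)
  have sw c d : q * c / d = c * (d^-1 * q ^+ 1) by rewrite expr1; ring.
  have sw' c d : q * c / d = c * (q / d * q ^+ 0) by rewrite expr0; ring.
  case: i => [[|[|[|[|k]]]] hk] //.
  - by have := key 1%N 1%N isT j; rewrite /= eE tauE -sw.
  - by have := key 1%N 2%N isT j; rewrite /= eE tauE -sw.
  - by have := key 1%N 3%N isT j; rewrite /= eE tauE -sw.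
  - by have := key 0%N 4%N isT j; rewrite /= eE tau4E -sw'.
have D1 := hC1; have D2 := hC2; have D3 := hC3.
rewrite !denE // in D1 D2 D3.
have H := connection_relation q0 q1 (a0 h1 _ ht1) (a0 h2 _ ht2) (a0 h3 _ ht3) a40
  (b0 l1 _ ht1) (b0 l2 _ ht2) (b0 l3 _ ht3) hx ab D1 D2 D3 qba.
move=> C1 C2 C3 phi.
rewrite /phi /phi_H3 /jackson /= fE eE !tauE tau4E.
rewrite /C1 /C2 /C3 /C_coef !numE // !denE //.
by rewrite -(mulr0 (cpow logx (nu - alpha))) -[in RHS]H; ring.
Qed.
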